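(* Let $n\geq 1$ be an integer and $\varepsilon\in\{0,1\}$. Then \[ \int_0^{\pi/4}\frac{\cos\!\left((4n-2+2\varepsilon)x-\frac{\pi\varepsilon}{2}\right)}{\ln(\tan x)}\,dx = \frac{(-1)^n}{2}\sum_{p=1}^{n} \frac{\Phi\!\left(2\varepsilon-1,\,2p+\varepsilon,\,\frac12\right)}{\pi^{2p-1+\varepsilon}}\, [x]\,U_{2n-2+\varepsilon}\!\left(\frac1x\right)(\arcsin x)^{2p-1+\varepsilon}. \]
   Context: $\Phi(q,s,a)=\sum_{j=0}^{\infty}\frac{q^j}{(j+a)^s}$ is the Lerch transcendent (in its domain of convergence). With $\beta(s)=\sum_{j\ge0}(-1)^j(2j+1)^{-s}$ the Dirichlet beta function and $\zeta$ the Riemann zeta function, $\Phi(2\varepsilon-1,2p+\varepsilon,\frac12)$ equals $2^{2p}\beta(2p)$ for $\varepsilon=0$ and $(2^{2p+1}-1)\zeta(2p+1)$ for $\varepsilon=1$. $U_m$ is the Chebyshev polynomial of the second kind, normalized by $U_m(\cos\theta)=\frac{\sin((m+1)\theta)}{\sin\theta}$. For a Laurent series $F$, $[x^r]F(x)$ denotes the coefficient of $x^r$ in the expansion of $F$ at the origin, and $[x]F(x)=[x^1]F(x)$; $\arcsin x$ is expanded as its Taylor series at $0$ (with $\arcsin 0=0$), so that $U_m(1/x)(\arcsin x)^r$ is a Laurent series in $x$. *)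

(* Defs.v *)
From Stdlib Require Import Reals Lra Lia ZArith ClassicalEpsilon.
From Coquelicot Require Import Coquelicot.

Open Scope R_scope.

(** Lerch transcendent with real parameters; [Rpower] is the real power only
    for a positive base, so this is meant for [a > 0]. *)
Definition Lerch (q s a : R) : R :=
  Series (fun j : nat => q ^ j / Rpower (INR j + a) s).

Fixpoint ChebyshevU (m : nat) (x : R) : R :=
  match m with
  | O => 1
  | S O => 2 * x
  | S (S k as m') => 2 * x * ChebyshevU m' x - ChebyshevU k x
  end.

Lemma ChebyshevU_cos (m : nat) (t : R) :
  ChebyshevU m (cos t) * sin t = sin (INR (S m) * t).
Proof.
enough (H : ChebyshevU m (cos t) * sin t = sin (INR (S m) * t) /\
  ChebyshevU (S m) (cos t) * sin t = sin (INR (S (S m)) * t)) by apply H.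
induction m as [|m [IH1 IH2]].
- split.
  + simpl. rewrite !Rmult_1_l. reflexivity.
  + replace (INR 2 * t) with (2 * t) by (simpl; ring).
    rewrite sin_2a. simpl. ring.
- split; [exact IH2|].
  change (ChebyshevU (S (S m)) (cos t))
    with (2 * cos t * ChebyshevU (S m) (cos t) - ChebyshevU m (cos t)).
  rewrite Rmult_minus_distr_r, Rmult_assoc, IH1, IH2.
  replace (INR (S m) * t) with (INR (S (S m)) * t - t)
    by (rewrite (S_INR (S m)); ring).
  replace (INR (S (S (S m))) * t) with (INR (S (S m)) * t + t)
    by (rewrite (S_INR (S (S m))); ring).
  rewrite sin_minus, sin_plus. ring.
Qed.

(** [c] is the family of coefficients of a Laurent expansion of [F] at the
    origin with finite principal part. *)
Definition is_laurent (F : R -> R) (c : Z -> R) : Prop :=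
  exists N : nat,
    (forall k : Z, (k < - Z.of_nat N)%Z -> c k = 0) /\
    locally' 0 (fun x : R =>
      is_series (fun j : nat =>
        c (Z.of_nat j - Z.of_nat N)%Z
          * powerRZ x (Z.of_nat j - Z.of_nat N)) (F x)).

(** The coefficient of [x^r] in [F]; junk when [F] has no Laurent expansion. *)
Definition laurent_coeff (r : Z) (F : R -> R) : R :=
  epsilon (inhabits (fun _ : Z => 0)) (is_laurent F) r.

Lemma is_laurent_shift (F : R -> R) (c : Z -> R) :
  is_laurent F c -> exists N : nat, forall M : nat, (N <= M)%nat ->
    (forall k : Z, (k < - Z.of_nat M)%Z -> c k = 0) /\
    locally' 0 (fun x : R =>
      is_pseries (fun j : nat => c (Z.of_nat j - Z.of_nat M)%Z) x
        (x ^ M * F x)).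
Proof.
intros [N [Hc HF]]. exists N. intros M HNM. split.
- intros k Hk. apply Hc. lia.
- destruct HF as [d HF]. exists d. intros x Hx Hx0.
  specialize (HF x Hx Hx0). simpl in HF.
  assert (H : is_pseries (fun j : nat => c (Z.of_nat j - Z.of_nat N)%Z) x
                (x ^ N * F x)).
  { apply (is_series_scal (x ^ N)) in HF.
    apply is_pseries_R.
    refine (is_series_ext _ _ _ _ HF). intros j.
    unfold scal; simpl; unfold mult; simpl.
    unfold Z.sub. rewrite powerRZ_add by exact Hx0.
    rewrite powerRZ_neg', <- !pow_powerRZ.
    field. apply pow_nonzero, Hx0. }
  apply (is_pseries_incr_n _ (M - N)) in H.
  replace (scal (pow_n x (M - N)) (x ^ N * F x))
    with (x ^ (M - N) * (x ^ N * F x)) in H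
    by (rewrite <- pow_n_pow; reflexivity).
  rewrite <- Rmult_assoc, <- pow_add in H.
  replace (M - N + N)%nat with M in H by lia.
  refine (is_series_ext _ _ _ _ H). intros j. f_equal.
  rewrite PS_incr_n_simplify.
  destruct (Compare_dec.le_lt_dec (M - N) j) as [Hj|Hj].
  + f_equal. lia.
  + symmetry. apply Hc. lia.
Qed.

Lemma CV_radius_pos (a : nat -> R) (G : R -> R) :
  locally' 0 (fun x : R => is_pseries a x (G x)) -> Rbar_lt 0 (CV_radius a).
Proof.
intros [d Hd].
assert (Hb : ball 0 d (d / 2)).
{ unfold ball; simpl; unfold AbsRing_ball, abs, minus, plus, opp; simpl.
  destruct d as [d d0]; simpl. rewrite Rabs_pos_eq; lra. }
assert (Hn : d / 2 <> 0) by (destruct d as [d d0]; simpl; lra).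
specialize (Hd _ Hb Hn).
apply Rbar_lt_le_trans with (Finite (Rabs (d / 2))).
- simpl. apply Rabs_pos_lt, Hn.
- apply Rbar_not_lt_le. intros Hlt. apply (CV_disk_outside _ _ Hlt).
  apply ex_series_lim_0. exists (G (d / 2)).
  apply is_pseries_R. exact Hd.
Qed.

Lemma is_laurent_unique (F : R -> R) (c c' : Z -> R) :
  is_laurent F c -> is_laurent F c' -> forall k : Z, c k = c' k.
Proof.
intros H H' k.
destruct (is_laurent_shift _ _ H) as [N HN].
destruct (is_laurent_shift _ _ H') as [N' HN'].
destruct (HN (N + N' + Z.abs_nat k)%nat ltac:(lia)) as [_ Ha].
destruct (HN' (N + N' + Z.abs_nat k)%nat ltac:(lia)) as [_ Hb].
set (M := (N + N' + Z.abs_nat k)%nat) in *.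
set (a := fun j : nat => c (Z.of_nat j - Z.of_nat M)%Z) in *.
set (b := fun j : nat => c' (Z.of_nat j - Z.of_nat M)%Z) in *.
pose proof (CV_radius_pos _ _ Ha) as Ra.
pose proof (CV_radius_pos _ _ Hb) as Rb.
assert (E : a (Z.to_nat (k + Z.of_nat M)) = b (Z.to_nat (k + Z.of_nat M))).
{ apply PSeries_ext_recip; try assumption.
  assert (Hoff : locally' 0 (fun x => PSeries a x = PSeries b x)).
  { generalize (filter_and _ _ Ha Hb). apply filter_imp. intros x [h1 h2].
    rewrite (is_pseries_unique _ _ _ h1), (is_pseries_unique _ _ _ h2).
    reflexivity. }
  assert (Hz : PSeries a 0 = PSeries b 0).
  { assert (La : is_lim (PSeries a) 0 (PSeries a 0))
      by (apply is_lim_continuity, PSeries_continuity; rewrite Rabs_R0; exact Ra).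
    assert (Lb : is_lim (PSeries b) 0 (PSeries b 0))
      by (apply is_lim_continuity, PSeries_continuity; rewrite Rabs_R0; exact Rb).
    apply (is_lim_ext_loc _ (PSeries b)) in La; [|exact Hoff].
    apply is_lim_unique in La. apply is_lim_unique in Lb.
    rewrite La in Lb. now injection Lb. }
  destruct Hoff as [d Hd]. exists d. intros x Hx.
  destruct (Req_dec x 0) as [->|Hx0]; [exact Hz|now apply Hd]. }
unfold a, b in E. rewrite Z2Nat.id in E by lia.
replace (k + Z.of_nat M - Z.of_nat M)%Z with k in E by lia. exact E.
Qed.

Lemma laurent_coeff_unique (F : R -> R) (c : Z -> R) (r : Z) :
  is_laurent F c -> laurent_coeff r F = c r.
Proof.
intros H. apply (is_laurent_unique F); [|exact H].
unfold laurent_coeff. apply epsilon_spec. now exists c.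
Qed.

(* Main.v *)
Require Import Defs.
From Stdlib Require Import Reals ZArith.
From Stdlib Require Import Lra Lia Psatz.
From Coquelicot Require Import Coquelicot.
Open Scope R_scope.

(** With [u = - ln (tan x)] one has [cos 2x = tanh u] and [sin 2x = / cosh u],
    and the numerator is [- (-1)^n cos 2x * U_m (sin 2x)], [m = 2n-2+eps]; so the
    integral is a combination of the moments
    [M_r = int_0^oo tanh u / (u cosh^r u) du].  For [z = sin v] their generating
    function is the integral of
    [z tanh u / (u (cosh u - z)) = (P (u, PI/2 - v) - P (u, PI/2)) / u], where
    [P (u, phi) = sinh u / (cosh u - cos phi)] is the Poisson kernel.  The
    partial fractions [P (u, phi) = sum_k 2u / (u^2 + (phi + 2 k PI)^2)] can be
    integrated explicitly and give
    [sum_r M_r z^r = sum_j (1 / (j + 1/2 - (-1)^j v/PI) - 1 / (j + 1/2))].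
    Expanding the right-hand side in powers of [v = asin z] produces the Lerch
    values, and comparing coefficients of [z^r] gives each [M_r].

    The partial fractions are obtained quantitatively from the duplication
    formula [P (u, phi) = (P (u/2, phi/2) + P (u/2, phi/2 + PI)) / 2]: the error
    of approximating [P] by its nearest poles is [O (u)], hence it becomes
    [O (u / 2^n)] after [n] duplications. *)

(** * Elementary inequalities *)

(** The mean value theorem. It integrates an inequality: each Taylor bound below comes from the
    bound on the derivative before it. *)
Lemma nonneg_of_derive (f f' : R -> R) (b : R) :
  f 0 = 0 ->
  (forall x, 0 <= x <= b -> is_derive f x (f' x)) ->
  (forall x, 0 <= x <= b -> 0 <= f' x) ->
  forall x, 0 <= x <= b -> 0 <= f x.
Proof.
intros f0 Hd Hp x Hx.
destruct (MVT_gen f 0 x f') as [c [Hc E]].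
- intros y Hy. rewrite Rmin_left, Rmax_right in Hy by lra. apply Hd. lra.
- intros y Hy. rewrite Rmin_left, Rmax_right in Hy by lra.
  apply derivable_continuous_pt. exists (f' y).
  apply is_derive_Reals, Hd. lra.
- rewrite Rmin_left, Rmax_right in Hc by lra.
  rewrite f0 in E. rewrite Rminus_0_r in E.
  assert (0 <= f' c * (x - 0)) by (apply Rmult_le_pos; [apply Hp|]; lra).
  lra.
Qed.

Lemma sin_ge_cubic (x : R) : 0 <= x -> x - x ^ 3 / 6 <= sin x.
Proof.
intros Hx.
assert (S1 : forall y, 0 <= y <= x -> 0 <= y - sin y).
{ apply nonneg_of_derive with (f' := fun y => 1 - cos y).
  - rewrite sin_0. ring.
  - intros y _. auto_derive; [trivial|ring].
  - intros y _. pose proof (COS_bound y). lra. }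
assert (S2 : forall y, 0 <= y <= x -> 0 <= cos y - 1 + y ^ 2 / 2).
{ apply nonneg_of_derive with (f' := fun y => y - sin y).
  - rewrite cos_0. field.
  - intros y _. auto_derive; [trivial|field].
  - exact S1. }
cut (0 <= sin x - x + x ^ 3 / 6); [lra|].
apply (nonneg_of_derive (fun y => sin y - y + y ^ 3 / 6)
  (fun y => cos y - 1 + y ^ 2 / 2) x).
- rewrite sin_0. field.
- intros y _. auto_derive; [trivial|field].
- exact S2.
- lra.
Qed.

Lemma cos_taylor_bounds (x : R) :
  0 <= x -> 1 - x ^ 2 / 2 <= cos x <= 1 - x ^ 2 / 2 + x ^ 4 / 24.
Proof.
intros Hx. split.
- cut (0 <= cos x - 1 + x ^ 2 / 2); [lra|].
  apply (nonneg_of_derive (fun y => cos y - 1 + y ^ 2 / 2)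
    (fun y => y - sin y) x).
  + rewrite cos_0. field.
  + intros y _. auto_derive; [trivial|field].
  + apply nonneg_of_derive with (f' := fun y => 1 - cos y).
    * rewrite sin_0. ring.
    * intros y _. auto_derive; [trivial|ring].
    * intros y _. pose proof (COS_bound y). lra.
  + lra.
- cut (0 <= 1 - x ^ 2 / 2 + x ^ 4 / 24 - cos x); [lra|].
  apply (nonneg_of_derive (fun y => 1 - y ^ 2 / 2 + y ^ 4 / 24 - cos y)
    (fun y => sin y - (y - y ^ 3 / 6)) x).
  + rewrite cos_0. field.
  + intros y _. auto_derive; [trivial|field].
  + intros y Hy. pose proof (sin_ge_cubic y). lra.
  + lra.
Qed.

Lemma cosh_ge_1 (u : R) : 1 <= cosh u.
Proof.
unfold cosh. rewrite exp_Ropp.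
pose proof (exp_pos u) as H.
apply Rmult_le_reg_l with (2 * exp u); [lra|].
replace (2 * exp u * ((exp u + / exp u) / 2)) with (exp u * exp u + 1)
  by (field; lra).
pose proof (Rle_0_sqr (exp u - 1)) as H2. unfold Rsqr in H2. lra.
Qed.

Lemma cosh_gt_1 (u : R) : 0 < u -> 1 < cosh u.
Proof.
intros Hu. unfold cosh. rewrite exp_Ropp.
pose proof (exp_ineq1 u) as H.
apply Rmult_lt_reg_l with (2 * exp u); [lra|].
replace (2 * exp u * ((exp u + / exp u) / 2)) with (exp u * exp u + 1)
  by (field; lra).
nra.
Qed.

Lemma sinh_nonneg (u : R) : 0 <= u -> 0 <= sinh u.
Proof.
intros Hu.
apply (nonneg_of_derive sinh cosh u).
- apply sinh_0.
- intros x _. auto_derive; [trivial|ring].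
- intros x _. pose proof (cosh_ge_1 x). lra.
- lra.
Qed.

Lemma sinh_ge_id (u : R) : 0 <= u -> u <= sinh u.
Proof.
intros Hu. cut (0 <= sinh u - u); [lra|].
apply (nonneg_of_derive (fun u => sinh u - u) (fun u => cosh u - 1) u).
- rewrite sinh_0. ring.
- intros x _. auto_derive; [trivial|ring].
- intros x _. pose proof (cosh_ge_1 x). lra.
- lra.
Qed.

Lemma cosh_ge_quadratic (u : R) : 0 <= u -> 1 + u ^ 2 / 2 <= cosh u.
Proof.
intros Hu. cut (0 <= cosh u - 1 - u ^ 2 / 2); [lra|].
apply (nonneg_of_derive (fun u => cosh u - 1 - u ^ 2 / 2)
  (fun u => sinh u - u) u).
- rewrite cosh_0. field.
- intros x _. auto_derive; [trivial|field].
- intros x Hx. pose proof (sinh_ge_id x). lra.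
- lra.
Qed.

(** On [[0, 1]] the crude bound [cosh x <= (3 + 1) / 2] is integrated four times from 0. *)
Lemma sinh_cosh_upper (u : R) : 0 <= u <= 1 ->
  sinh u <= u + u ^ 3 / 3 /\ cosh u <= 1 + u ^ 2 / 2 + u ^ 4 / 12.
Proof.
assert (C0 : forall x, 0 <= x <= 1 -> cosh x <= 2).
{ intros x Hx. unfold cosh.
  assert (exp x <= 3).
  { apply Rle_trans with (exp 1); [|apply exp_le_3].
    destruct (Rle_lt_or_eq_dec x 1 (proj2 Hx)) as [h|h];
      [left; now apply exp_increasing|rewrite h; lra]. }
  assert (exp (- x) <= 1).
  { rewrite <- exp_0. destruct (Rle_lt_or_eq_dec 0 x (proj1 Hx)) as [h|h].
    - left. apply exp_increasing. lra.
    - rewrite <- h, Ropp_0. lra. }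
  lra. }
assert (S0 : forall x, 0 <= x <= 1 -> 0 <= 2 * x - sinh x).
{ apply nonneg_of_derive with (f' := fun x => 2 - cosh x).
  - rewrite sinh_0. ring.
  - intros x _. auto_derive; [trivial|ring].
  - intros x Hx. pose proof (C0 x Hx). lra. }
assert (C1 : forall x, 0 <= x <= 1 -> 0 <= 1 + x ^ 2 - cosh x).
{ apply nonneg_of_derive with (f' := fun x => 2 * x - sinh x).
  - rewrite cosh_0. ring.
  - intros x _. auto_derive; [trivial|ring].
  - exact S0. }
assert (S1 : forall x, 0 <= x <= 1 -> 0 <= x + x ^ 3 / 3 - sinh x).
{ apply nonneg_of_derive with (f' := fun x => 1 + x ^ 2 - cosh x).
  - rewrite sinh_0. field.
  - intros x _. auto_derive; [trivial|field].
  - exact C1. }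
assert (C2 : forall x, 0 <= x <= 1 ->
  0 <= 1 + x ^ 2 / 2 + x ^ 4 / 12 - cosh x).
{ apply nonneg_of_derive with (f' := fun x => x + x ^ 3 / 3 - sinh x).
  - rewrite cosh_0. field.
  - intros x _. auto_derive; [trivial|field].
  - exact S1. }
intros Hu. pose proof (S1 u Hu). pose proof (C2 u Hu). lra.
Qed.

(* The real part of [coth ((u + i phi) / 2)]. *)
Definition poisson (u phi : R) : R := sinh u / (cosh u - cos phi).

(** The sum [1 / (u - i c) + 1 / (u + i c)] over two conjugate poles. *)
Definition lorentz (u c : R) : R := 2 * u / (u ^ 2 + c ^ 2).

(** With [s = u^2 + phi^2], the denominator [D] is [s / 2] up to [s^2 / 12] and [sinh u] is [u] up
    to [u s / 3]. The numerator of the difference is thus at most [u s^2 / 2], and [D s >= s^2 / 16]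
    gives the factor 8. *)
Lemma poisson_near_pole (u phi : R) :
  0 < u <= 1 -> 0 <= phi <= PI ->
  Rabs (poisson u phi - lorentz u phi) <= 8 * u.
Proof.
intros Hu Hphi. unfold poisson, lorentz.
destruct (sinh_cosh_upper u) as [S C]; [lra|].
pose proof (sinh_ge_id u) as S'. pose proof (cosh_ge_quadratic u) as C'.
destruct (cos_taylor_bounds phi) as [P P']; [lra|].
pose proof PI_4 as HPI.
set (s := u ^ 2 + phi ^ 2).
assert (Hs : 0 < s) by (unfold s; nra).
set (D := cosh u - cos phi).
(* For [phi^2 <= 10] the quartic term uses up at most [5/12] of the [1/2] in front of [phi^2].
   Otherwise [cos phi <= 0], so [D >= 1 + u^2 / 2], while [phi^2 <= 16]. *)
assert (HD : s / 16 <= D).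
{ destruct (Rle_lt_dec (phi ^ 2) 10) as [h|h].
  - assert (phi ^ 4 / 24 <= phi ^ 2 * 5 / 12).
    { replace (phi ^ 4) with (phi ^ 2 * phi ^ 2) by ring. nra. }
    unfold D, s. nra.
  - assert (cos phi <= 0) by (apply cos_le_0; nra).
    assert (phi ^ 2 <= 16) by nra.
    unfold D, s. nra. }
assert (HD0 : 0 < D) by lra.
replace (sinh u / D - 2 * u / s)
  with (((sinh u - u) * s - 2 * u * (D - s / 2)) / (D * s)) by (field; lra).
assert (N1 : Rabs (D - s / 2) <= s ^ 2 / 12).
{ apply Rabs_le. unfold D, s.
  assert (0 <= u ^ 2 * phi ^ 2) by nra.
  replace ((u ^ 2 + phi ^ 2) ^ 2)
    with (u ^ 4 + 2 * (u ^ 2 * phi ^ 2) + phi ^ 4) by ring.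
  assert (0 <= u ^ 4) by nra. assert (0 <= phi ^ 4) by nra.
  split; lra. }
assert (N2 : 0 <= (sinh u - u) * s <= u * s ^ 2 / 3).
{ assert (sinh u - u <= u * s / 3) by (unfold s; nra).
  split; [apply Rmult_le_pos; lra|].
  replace (u * s ^ 2 / 3) with (u * s / 3 * s) by field.
  apply Rmult_le_compat_r; lra. }
unfold Rdiv. rewrite Rabs_mult.
rewrite (Rabs_pos_eq (/ (D * s))) by (left; apply Rinv_0_lt_compat; nra).
apply Rmult_le_reg_r with (D * s); [nra|].
rewrite Rmult_assoc, Rinv_l, Rmult_1_r by nra.
apply Rle_trans with (u * s ^ 2 / 2).
- apply Rabs_le. apply Rabs_le_between in N1.
  assert (- (u * (s ^ 2 / 12)) <= u * (D - s / 2) <= u * (s ^ 2 / 12)) by nra.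
  assert (0 <= u * s ^ 2) by nra.
  split; lra.
- assert (s / 16 * (u * s) <= D * (u * s)) by (apply Rmult_le_compat_r; nra).
  nra.
Qed.

(** * Partial fractions of the Poisson kernel *)

(** The upper bound is exclusive, unlike in [sum_n]: there is an empty sum, and doubling the number
    of terms is exact. *)
Fixpoint rsum (f : nat -> R) (n : nat) : R :=
  match n with
  | O => 0
  | S k => rsum f k + f k
  end.

Lemma sum_n_rsum (f : nat -> R) (n : nat) : sum_n f n = rsum f (S n).
Proof.
induction n as [|n IH].
- rewrite sum_O. simpl. ring.
- rewrite sum_Sn, IH. reflexivity.
Qed.

Lemma rsum_ext (f g : nat -> R) (n : nat) :
  (forall k, (k < n)%nat -> f k = g k) -> rsum f n = rsum g n.
Proof.
intros H. induction n as [|n IH]; simpl; [reflexivity|].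
rewrite IH by (intros; apply H; lia). rewrite H by lia. reflexivity.
Qed.

Lemma rsum_le (f g : nat -> R) (n : nat) :
  (forall k, (k < n)%nat -> f k <= g k) -> rsum f n <= rsum g n.
Proof.
intros H. induction n as [|n IH]; simpl; [lra|].
apply Rplus_le_compat; [apply IH; intros; apply H; lia|apply H; lia].
Qed.

Lemma rsum_plus (f g : nat -> R) (n : nat) :
  rsum (fun k => f k + g k) n = rsum f n + rsum g n.
Proof. induction n as [|n IH]; simpl; [ring|rewrite IH; ring]. Qed.

Lemma rsum_minus (f g : nat -> R) (n : nat) :
  rsum (fun k => f k - g k) n = rsum f n - rsum g n.
Proof. induction n as [|n IH]; simpl; [ring|rewrite IH; ring]. Qed.

Lemma rsum_scal (c : R) (f : nat -> R) (n : nat) :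
  rsum (fun k => c * f k) n = c * rsum f n.
Proof. induction n as [|n IH]; simpl; [ring|rewrite IH; ring]. Qed.

Lemma rsum_zero (f : nat -> R) (n : nat) :
  (forall k, (k < n)%nat -> f k = 0) -> rsum f n = 0.
Proof.
intros H. induction n as [|n IH]; simpl; [reflexivity|].
rewrite IH by (intros; apply H; lia). rewrite H by lia. ring.
Qed.

Lemma rsum_swap (f : nat -> nat -> R) (m n : nat) :
  rsum (fun i => rsum (f i) n) m = rsum (fun j => rsum (fun i => f i j) m) n.
Proof.
induction m as [|m IH]; simpl.
- symmetry. apply rsum_zero. reflexivity.
- rewrite IH, <- rsum_plus. reflexivity.
Qed.

Lemma rsum_Rabs (f : nat -> R) (n : nat) :
  Rabs (rsum f n) <= rsum (fun k => Rabs (f k)) n.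
Proof.
induction n as [|n IH]; simpl.
- rewrite Rabs_R0. lra.
- apply Rle_trans with (1 := Rabs_triang _ _). lra.
Qed.

Lemma rsum_S_l (f : nat -> R) (n : nat) :
  rsum f (S n) = f 0%nat + rsum (fun k => f (S k)) n.
Proof.
induction n as [|n IH]; [simpl; ring|].
change (rsum f (S (S n))) with (rsum f (S n) + f (S n)).
rewrite IH. simpl. ring.
Qed.

Lemma rsum_pairs (f : nat -> R) (n : nat) :
  rsum f (2 * n) = rsum (fun k => f (2 * k)%nat + f (2 * k + 1)%nat) n.
Proof.
induction n as [|n IH]; [reflexivity|].
replace (2 * S n)%nat with (S (S (2 * n))) by lia.
change (rsum f (S (S (2 * n))))
  with (rsum f (2 * n) + f (2 * n)%nat + f (S (2 * n))).
change (rsum (fun k => f (2 * k)%nat + f (2 * k + 1)%nat) (S n))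
  with (rsum (fun k => f (2 * k)%nat + f (2 * k + 1)%nat) n
        + (f (2 * n)%nat + f (2 * n + 1)%nat)).
rewrite IH. replace (2 * n + 1)%nat with (S (2 * n)) by lia. ring.
Qed.

(* The values [|phi + 2 k PI|], [k] an integer, are grouped two by two so that
   sums over them run over natural numbers. *)
Definition pole_pair (g : R -> R) (phi : R) (k : nat) : R :=
  g (phi + 2 * PI * INR k) + g (2 * PI * (INR k + 1) - phi).

(** One of [phi] and [2 PI - phi] lies in [[0, PI]] and is treated as the near pole, with error
    [8 u]; the kernel takes the same value at both. The other one is at least [PI] and contributes
    at most [u]. *)
Lemma poisson_two_poles (u phi : R) :
  0 < u <= 1 -> 0 < phi < 2 * PI ->
  Rabs (poisson u phi - pole_pair (lorentz u) phi 0) <= 9 * u.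
Proof.
intros Hu Hphi. unfold pole_pair. simpl INR.
replace (phi + 2 * PI * 0) with phi by ring.
replace (2 * PI * (0 + 1) - phi) with (2 * PI - phi) by ring.
assert (far : forall c, PI <= c -> 0 <= lorentz u c <= u).
{ intros c Hc. pose proof PI2_1. unfold lorentz.
  assert (0 < u ^ 2 + c ^ 2) by nra. split.
  - apply Rmult_le_pos; [lra|left; now apply Rinv_0_lt_compat].
  - apply Rmult_le_reg_r with (u ^ 2 + c ^ 2); [lra|].
    unfold Rdiv. rewrite Rmult_assoc, Rinv_l by lra.
    assert (2 <= u ^ 2 + c ^ 2) by nra. nra. }
destruct (Rle_lt_dec phi PI) as [h|h].
- assert (H := poisson_near_pole u phi Hu (conj (Rlt_le _ _ (proj1 Hphi)) h)).
  pose proof (far (2 * PI - phi) ltac:(lra)).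
  apply Rabs_le. apply Rabs_le_between in H. lra.
- assert (H : Rabs (poisson u (2 * PI - phi) - lorentz u (2 * PI - phi))
              <= 8 * u) by (apply poisson_near_pole; lra).
  pose proof (far phi ltac:(lra)).
  assert (E : poisson u (2 * PI - phi) = poisson u phi).
  { unfold poisson. rewrite cos_minus, cos_2PI, sin_2PI. f_equal. ring. }
  rewrite E in H. apply Rabs_le. apply Rabs_le_between in H. lra.
Qed.

(** Real part of [coth (2 w) = (coth w + tanh w) / 2] at [w = (u + i phi) / 4], where
    [tanh w = coth (w + i PI / 2)]. *)
Lemma poisson_duplication (u phi : R) :
  0 < u ->
  poisson u phi
  = (poisson (u / 2) (phi / 2) + poisson (u / 2) (phi / 2 + PI)) / 2.
Proof.
intros Hu. unfold poisson. rewrite neg_cos.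
assert (Hc : 1 < cosh (u / 2)) by (apply cosh_gt_1; lra).
assert (Eu : sinh u = 2 * sinh (u / 2) * cosh (u / 2)
             /\ cosh u = 2 * cosh (u / 2) ^ 2 - 1).
{ unfold sinh, cosh. rewrite !exp_Ropp.
  assert (E : exp u = exp (u / 2) * exp (u / 2))
    by (rewrite <- exp_plus; f_equal; field).
  rewrite E. pose proof (exp_pos (u / 2)). split; field; lra. }
assert (Ep : cos phi = 2 * cos (phi / 2) ^ 2 - 1).
{ replace phi with (2 * (phi / 2)) at 1 by field. rewrite cos_2a_cos. ring. }
destruct Eu as [Es Ec]. rewrite Es, Ec, Ep.
pose proof (COS_bound (phi / 2)).
field. repeat split; nra.
Qed.

Lemma lorentz_half (u c : R) :
  0 < u -> lorentz (u / 2) (c / 2) = 2 * lorentz u c.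
Proof. intros Hu. unfold lorentz. field. nra. Qed.

(** Each duplication averages two approximations at [u / 2], so the error is halved while the number
    of pole pairs doubles. *)
Lemma poisson_dyadic (n : nat) : forall u phi : R,
  0 < u <= 2 ^ n -> 0 < phi < 2 * PI ->
  Rabs (poisson u phi - rsum (pole_pair (lorentz u) phi) (2 ^ n))
  <= 9 * u / 2 ^ n.
Proof.
induction n as [|n IH]; intros u phi Hu Hphi.
- simpl in *. rewrite Rplus_0_l.
  replace (9 * u / 1) with (9 * u) by field. now apply poisson_two_poles.
- simpl in Hu.
  pose proof (IH (u / 2) (phi / 2) ltac:(lra) ltac:(lra)) as H1.
  pose proof (IH (u / 2) (phi / 2 + PI) ltac:(lra) ltac:(lra)) as H2.
  rewrite poisson_duplication by lra.
  replace (2 ^ S n)%nat with (2 * 2 ^ n)%nat by reflexivity.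
  rewrite rsum_pairs.
  replace (rsum (fun k : nat => pole_pair (lorentz u) phi (2 * k) +
                   pole_pair (lorentz u) phi (2 * k + 1)) (2 ^ n))
    with ((rsum (pole_pair (lorentz (u / 2)) (phi / 2)) (2 ^ n)
           + rsum (pole_pair (lorentz (u / 2)) (phi / 2 + PI)) (2 ^ n)) / 2).
  + replace (9 * u / 2 ^ S n) with (9 * (u / 2) / 2 ^ n)
      by (simpl; field; apply pow_nonzero; lra).
    apply Rabs_le. apply Rabs_le_between in H1. apply Rabs_le_between in H2.
    lra.
  (* The pairs of index [k] at [phi / 2] and at [phi / 2 + PI], scaled by 2, contain the same four
     poles as the pairs [2 k] and [2 k + 1] at [phi], with the reflected members exchanged. *)
  + rewrite <- rsum_plus. unfold Rdiv. rewrite Rmult_comm, <- rsum_scal.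
    apply rsum_ext. intros k _. unfold pole_pair.
    rewrite plus_INR, mult_INR. simpl INR.
    replace (phi * / 2 + 2 * PI * INR k)
      with ((phi + 2 * PI * (2 * INR k)) / 2) by field.
    replace (2 * PI * (INR k + 1) - phi * / 2)
      with ((2 * PI * (2 * INR k + 1 + 1) - phi) / 2) by field.
    replace (phi * / 2 + PI + 2 * PI * INR k)
      with ((phi + 2 * PI * (2 * INR k + 1)) / 2) by field.
    replace (2 * PI * (INR k + 1) - (phi * / 2 + PI))
      with ((2 * PI * (2 * INR k + 1) - phi) / 2) by field.
    change (u * / 2) with (u / 2).
    rewrite !lorentz_half by lra.
    replace (1 + 1) with 2 by ring. field.
Qed.

(** * Integration of the partial fractions *)

(** The value at 0 makes the function continuous, so that integrability on closed intervals follows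
    from continuity. *)
Definition tanhc (u : R) : R := if Req_EM_T u 0 then 1 else tanh u / u.

Lemma is_derive_tanh (u : R) : is_derive tanh u (1 - tanh u ^ 2).
Proof.
unfold tanh. pose proof (cosh_ge_1 u). auto_derive; [lra|]. field. lra.
Qed.

Lemma continuous_tanhc (u : R) : continuous tanhc u.
Proof.
destruct (Req_dec u 0) as [->|Hu].
- apply filterlim_locally. intros e.
  (* At 0 the quotient [tanh y / y] is the difference quotient of [tanh], whose derivative there is
     1. *)
  pose proof (is_derive_tanh 0) as D. apply is_derive_Reals in D.
  destruct (D e (cond_pos e)) as [d Hd]. exists d. intros y Hy.
  unfold tanhc. destruct (Req_EM_T 0 0) as [_|]; [|lra].
  destruct (Req_EM_T y 0) as [_|Hy0]; [apply ball_center|].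
  assert (T0 : tanh 0 = 0) by (unfold tanh; rewrite sinh_0; field;
    pose proof (cosh_ge_1 0); lra).
  specialize (Hd y Hy0). rewrite Rplus_0_l, T0 in Hd.
  replace ((tanh y - 0) / y - (1 - 0 ^ 2)) with (tanh y / y - 1) in Hd
    by (simpl; field; exact Hy0).
  apply Hd. unfold ball in Hy; simpl in Hy.
  unfold AbsRing_ball, abs, minus, plus, opp in Hy; simpl in Hy.
  now rewrite Ropp_0, Rplus_0_r in Hy.
- apply continuous_ext_loc with (fun y => tanh y / y).
  + exists (mkposreal _ (Rabs_pos_lt _ Hu)). intros y Hy.
    unfold tanhc. destruct (Req_EM_T y 0) as [->|]; [|reflexivity].
    exfalso. unfold ball in Hy; simpl in Hy.
    unfold AbsRing_ball, abs, minus, plus, opp in Hy; simpl in Hy.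
    rewrite Rplus_0_l, Rabs_Ropp in Hy. lra.
  + apply (ex_derive_continuous (fun y => tanh y / y)).
    pose proof (is_derive_tanh u). auto_derive.
    split; [eexists; eassumption|]. split; trivial.
Qed.

Lemma tanhc_bounds (u : R) : 0 <= u -> 0 <= tanhc u <= 1.
Proof.
intros Hu. unfold tanhc. destruct (Req_EM_T u 0); [lra|].
assert (B : forall x, 0 <= x <= u -> 0 <= x - tanh x).
{ apply nonneg_of_derive with (f' := fun x => tanh x ^ 2).
  - unfold tanh. rewrite sinh_0. field. pose proof (cosh_ge_1 0). lra.
  - intros x _. pose proof (is_derive_tanh x) as D.
    auto_derive; [eexists; exact D|].
    change (fun x0 : R => tanh x0) with tanh.
    rewrite (is_derive_unique _ _ _ D). ring.
  - intros x _. nra. }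
specialize (B u ltac:(lra)).
assert (0 <= tanh u).
{ unfold tanh. pose proof (cosh_ge_1 u). pose proof (sinh_nonneg u Hu).
  apply Rmult_le_pos; [lra|]. left. apply Rinv_0_lt_compat. lra. }
assert (0 < / u) by (apply Rinv_0_lt_compat; lra).
split; [apply Rmult_le_pos; lra|].
apply Rmult_le_reg_r with u; [lra|]. unfold Rdiv.
rewrite Rmult_assoc, Rinv_l; lra.
Qed.

(** For [0 <= z < 1] this is the geometric sum over [r >= 1] of [z^r tanhc u / cosh^r u]. *)
Definition gen_kernel (z u : R) : R := tanhc u * (z / (cosh u - z)).

Lemma continuous_gen_kernel (z u : R) : z < 1 -> continuous (gen_kernel z) u.
Proof.
intros Hz. unfold gen_kernel. apply (continuous_mult tanhc).
- apply continuous_tanhc.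
- apply (ex_derive_continuous (fun u => z / (cosh u - z))).
  pose proof (cosh_ge_1 u). auto_derive. lra.
Qed.

Lemma gen_kernel_poisson (v u : R) :
  0 < u ->
  gen_kernel (sin v) u
  = (poisson u (PI / 2 - v) - poisson u (PI / 2)) * / u.
Proof.
intros Hu. unfold gen_kernel, tanhc, poisson.
destruct (Req_EM_T u 0); [lra|].
rewrite cos_shift, cos_PI2. unfold tanh.
pose proof (cosh_gt_1 u Hu). pose proof (SIN_bound v).
field. repeat split; lra.
Qed.

(** Generic in [g] because the same combination of poles serves the integrand, its integral up to
    [U], the limit [PI / c] and the tail. *)
Definition pole_diff (g : R -> R) (v : R) (k : nat) : R :=
  pole_pair g (PI / 2 - v) k - pole_pair g (PI / 2) k.

(** The kernel is a difference of two Poisson kernels divided by [u], which cancels the [u] in both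
    errors [9 u / 2^n]. The bound is then uniform in [u] and can be integrated. *)
Lemma gen_kernel_approx (n : nat) (v u : R) :
  0 < v < PI / 2 -> 0 < u <= 2 ^ n ->
  Rabs (gen_kernel (sin v) u
        - rsum (pole_diff (fun c => 2 / (u ^ 2 + c ^ 2)) v) (2 ^ n))
  <= 18 / 2 ^ n.
Proof.
intros Hv Hu. rewrite gen_kernel_poisson by lra.
pose proof (poisson_dyadic n u (PI / 2 - v) Hu ltac:(lra)) as H1.
pose proof (poisson_dyadic n u (PI / 2) Hu ltac:(lra)) as H2.
assert (E : rsum (pole_diff (fun c => 2 / (u ^ 2 + c ^ 2)) v) (2 ^ n)
  = (rsum (pole_pair (lorentz u) (PI / 2 - v)) (2 ^ n)
     - rsum (pole_pair (lorentz u) (PI / 2)) (2 ^ n)) * / u).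
{ rewrite <- rsum_minus. rewrite Rmult_comm, <- rsum_scal.
  apply rsum_ext. intros k _. unfold pole_diff, pole_pair.
  assert (L : forall c, 2 / (u ^ 2 + c ^ 2) = / u * lorentz u c)
    by (intros c; unfold lorentz; field; split; nra).
  rewrite !L. ring. }
rewrite E. rewrite <- Rmult_minus_distr_r, Rabs_mult.
rewrite (Rabs_pos_eq (/ u)) by (left; apply Rinv_0_lt_compat; lra).
assert (0 < 2 ^ n) by (apply pow_lt; lra).
apply Rmult_le_reg_r with u; [lra|].
rewrite Rmult_assoc, Rinv_l, Rmult_1_r by lra.
replace (18 / 2 ^ n * u) with (9 * u / 2 ^ n + 9 * u / 2 ^ n)
  by (field; lra).
apply Rabs_le. apply Rabs_le_between in H1. apply Rabs_le_between in H2. lra.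
Qed.

Lemma is_RInt_rsum (f : nat -> R -> R) (l : nat -> R) (a b : R) (n : nat) :
  (forall k, (k < n)%nat -> is_RInt (f k) a b (l k)) ->
  is_RInt (fun x => rsum (fun k => f k x) n) a b (rsum l n).
Proof.
intros H. induction n as [|n IH]; simpl.
- pose proof (is_RInt_const (V := R_NormedModule) a b 0) as Z.
  apply (eq_ind _ (fun l => is_RInt (fun _ : R => 0) a b l) Z).
  unfold scal; simpl; unfold mult; simpl. ring.
- apply (is_RInt_plus (fun x => rsum (fun k => f k x) n) (f n)).
  + apply IH. intros. apply H. lia.
  + apply H. lia.
Qed.

Definition lorentz_int (U c : R) : R := 2 / c * atan (U / c).

Lemma is_RInt_lorentz (U c : R) :
  0 < c -> is_RInt (fun u => 2 / (u ^ 2 + c ^ 2)) 0 U (lorentz_int U c).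
Proof.
intros Hc.
replace (lorentz_int U c)
  with (minus (lorentz_int U c) (lorentz_int 0 c)).
- apply (is_RInt_derive (fun u => lorentz_int u c)
    (fun u => 2 / (u ^ 2 + c ^ 2))).
  + intros x _. unfold lorentz_int. auto_derive; [trivial|].
    field. repeat split; nra.
  + intros x _. apply (ex_derive_continuous (fun u => 2 / (u ^ 2 + c ^ 2))).
    auto_derive. nra.
- unfold lorentz_int, minus, plus, opp; simpl.
  rewrite (Rdiv_0_l c), atan_0. ring.
Qed.

Lemma pole_positions (v : R) (k : nat) : 0 <= v < PI / 2 ->
  0 < PI / 2 - v + 2 * PI * INR k /\
  0 < 2 * PI * (INR k + 1) - (PI / 2 - v).
Proof. intros Hv. pose proof (pos_INR k). split; nra. Qed.

Lemma gen_integral_approx (n : nat) (v U : R) :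
  0 < v < PI / 2 -> 0 < U <= 2 ^ n ->
  Rabs (RInt (gen_kernel (sin v)) 0 U
        - rsum (pole_diff (lorentz_int U) v) (2 ^ n))
  <= 18 * U / 2 ^ n.
Proof.
intros Hv HU.
assert (Hz : sin v < 1).
{ rewrite <- sin_PI2. apply sin_increasing_1; lra. }
set (S := fun u => rsum (pole_diff (fun c => 2 / (u ^ 2 + c ^ 2)) v) (2 ^ n)).
set (e := 18 / 2 ^ n).
assert (IS : is_RInt S 0 U (rsum (pole_diff (lorentz_int U) v) (2 ^ n))).
{ unfold S.
  apply (is_RInt_rsum (fun k u => pole_diff (fun c => 2 / (u^2 + c^2)) v k)).
  intros k _. unfold pole_diff, pole_pair.
  destruct (pole_positions v k ltac:(lra)) as [p1 p2].
  destruct (pole_positions 0 k ltac:(lra)) as [p3 p4].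
  rewrite Rminus_0_r in p3, p4.
  apply (is_RInt_minus (V := R_NormedModule)).
  - apply (is_RInt_plus (V := R_NormedModule)); now apply is_RInt_lorentz.
  - apply (is_RInt_plus (V := R_NormedModule)); now apply is_RInt_lorentz. }
assert (IG : is_RInt (gen_kernel (sin v)) 0 U
               (RInt (gen_kernel (sin v)) 0 U)).
{ apply (RInt_correct (gen_kernel (sin v))).
  apply (ex_RInt_continuous (gen_kernel (sin v))).
  intros u _. now apply continuous_gen_kernel. }
assert (Ie : is_RInt (fun _ : R => e) 0 U (18 * U / 2 ^ n)).
{ replace (18 * U / 2 ^ n) with (scal (U - 0) e).
  - apply (is_RInt_const 0 U e).
  - unfold e, scal; simpl; unfold mult; simpl. field.
    apply pow_nonzero; lra. }
assert (B : forall u, 0 < u < U -> Rabs (gen_kernel (sin v) u - S u) <= e)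
  by (intros u Hu; apply gen_kernel_approx; lra).
apply Rabs_le. split.
- apply Ropp_le_cancel. rewrite Ropp_involutive, Ropp_minus_distr.
  apply (is_RInt_le (fun u => S u - gen_kernel (sin v) u) (fun _ => e) 0 U).
  + lra.
  + now apply (is_RInt_minus (V := R_NormedModule)).
  + exact Ie.
  + intros u Hu. specialize (B u Hu). apply Rabs_le_between in B. lra.
- apply (is_RInt_le (fun u => gen_kernel (sin v) u - S u) (fun _ => e) 0 U).
  + lra.
  + now apply (is_RInt_minus (V := R_NormedModule)).
  + exact Ie.
  + intros u Hu. specialize (B u Hu). apply Rabs_le_between in B. lra.
Qed.

(** For positive [U] and [c], the integral of [2 / (u^2 + c^2)] from [U] to infinity. The inverted
    argument gives a bound [2 / U] independent of [c]. *)
Definition lorentz_tail (U c : R) : R := 2 / c * atan (c / U).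

Lemma lorentz_int_tail (U c : R) :
  0 < U -> 0 < c -> lorentz_int U c = PI / c - lorentz_tail U c.
Proof.
intros HU Hc. unfold lorentz_int, lorentz_tail.
replace (U / c) with (/ (c / U)) by (field; lra).
rewrite atan_inv.
- field. lra.
- apply Rdiv_lt_0_compat; lra.
Qed.

Lemma atan_le_id (x : R) : 0 <= x -> atan x <= x.
Proof.
intros Hx. cut (0 <= x - atan x); [lra|].
apply (nonneg_of_derive (fun x => x - atan x)
  (fun x => x ^ 2 / (1 + x ^ 2)) x).
- rewrite atan_0. ring.
- intros y _. auto_derive; [trivial|]. field. nra.
- intros y _. apply Rmult_le_pos; [nra|]. left. apply Rinv_0_lt_compat. nra.
- lra.
Qed.

(** For positive [x] this is the sign of the derivative of [atan x / x], hence the monotonicity of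
    [lorentz_tail] in [c]. *)
Lemma atan_ge_rational (x : R) : 0 <= x -> x / (1 + x ^ 2) <= atan x.
Proof.
intros Hx. cut (0 <= atan x - x / (1 + x ^ 2)); [lra|].
apply (nonneg_of_derive (fun x => atan x - x / (1 + x ^ 2))
  (fun x => 2 * x ^ 2 / (1 + x ^ 2) ^ 2) x).
- rewrite atan_0. field.
- intros y _. auto_derive; [nra|]. field. nra.
- intros y _. apply Rmult_le_pos; [nra|]. left. apply Rinv_0_lt_compat. nra.
- lra.
Qed.

Lemma lorentz_tail_bounds (U c : R) :
  0 < U -> 0 < c -> 0 <= lorentz_tail U c <= 2 / U.
Proof.
intros HU Hc. unfold lorentz_tail.
assert (Hx : 0 < c / U) by (apply Rdiv_lt_0_compat; lra).
assert (H2 : 0 < 2 / c) by (apply Rdiv_lt_0_compat; lra).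
split.
- apply Rmult_le_pos; [lra|]. rewrite <- atan_0. left.
  now apply atan_increasing.
- replace (2 / U) with (2 / c * (c / U)) by (field; lra).
  apply Rmult_le_compat_l; [lra|]. apply atan_le_id. lra.
Qed.

Lemma lorentz_tail_decreasing (U c c' : R) :
  0 < U -> 0 < c <= c' -> lorentz_tail U c' <= lorentz_tail U c.
Proof.
intros HU Hc.
destruct (MVT_gen (lorentz_tail U) c c'
  (fun x => - (2 / x ^ 2)
            * (atan (x / U) - (x / U) / (1 + (x / U) ^ 2))))
  as [y [Hy E]].
- intros x Hx. rewrite Rmin_left, Rmax_right in Hx by lra.
  unfold lorentz_tail. auto_derive; [lra|].
  change (x * / U) with (x / U). field. repeat split; nra.
- intros x Hx. rewrite Rmin_left, Rmax_right in Hx by lra.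
  apply continuity_pt_filterlim.
  apply (ex_derive_continuous (lorentz_tail U)).
  unfold lorentz_tail. auto_derive. lra.
- rewrite Rmin_left, Rmax_right in Hy by lra.
  pose proof (atan_ge_rational (y / U)
    (Rlt_le _ _ (Rdiv_lt_0_compat y U ltac:(lra) HU))) as A.
  assert (0 < 2 / y ^ 2) by (apply Rdiv_lt_0_compat; nra).
  assert (0 <= 2 / y ^ 2 * (atan (y / U) - y / U / (1 + (y / U) ^ 2))
               * (c' - c)).
  { apply Rmult_le_pos; [|lra]. apply Rmult_le_pos; lra. }
  lra.
Qed.

(** The intervals [[x k, y k]] follow one another without overlap, so the drops of [g] over them add
    up to at most its total drop, whatever their number. *)
Lemma alternating_bound (g : R -> R) (m : R) (x y : nat -> R) (n : nat) :
  (forall c, 0 < c -> 0 <= g c <= m) ->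
  (forall c c', 0 < c <= c' -> g c' <= g c) ->
  (forall k, 0 < x k <= y k) -> (forall k, y k <= x (S k)) ->
  0 <= rsum (fun k => g (x k) - g (y k)) n <= m.
Proof.
intros Hm Hd Hxy Hyx.
assert (H : 0 <= rsum (fun k => g (x k) - g (y k)) n <= g (x 0%nat) - g (x n)).
{ induction n as [|n IH]; simpl; [lra|].
  pose proof (Hd (x n) (y n) (Hxy n)).
  pose proof (Hd (y n) (x (S n))
    (conj (Rlt_le_trans _ _ _ (proj1 (Hxy n)) (proj2 (Hxy n))) (Hyx n))).
  lra. }
pose proof (Hm _ (proj1 (Hxy 0%nat))). pose proof (Hm _ (proj1 (Hxy n))). lra.
Qed.

(** Bounding the tails one by one would cost a factor [n]. Grouped by the direction in which [v]
    moves the pole, they form two sums in [[0, 2 / U]], and these are subtracted. *)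
Lemma pole_diff_tail (n : nat) (v U : R) :
  0 < v < PI / 2 -> 0 < U ->
  Rabs (rsum (pole_diff (lorentz_tail U) v) n) <= 2 / U.
Proof.
intros Hv HU. pose proof PI_RGT_0 as HPI.
assert (A := alternating_bound (lorentz_tail U) (2 / U)
  (fun k => PI / 2 - v + 2 * PI * INR k) (fun k => PI / 2 + 2 * PI * INR k) n
  (fun c => lorentz_tail_bounds U c HU)
  (fun c c' => lorentz_tail_decreasing U c c' HU)).
assert (B := alternating_bound (lorentz_tail U) (2 / U)
  (fun k => 2 * PI * (INR k + 1) - PI / 2)
  (fun k => 2 * PI * (INR k + 1) - (PI / 2 - v)) n
  (fun c => lorentz_tail_bounds U c HU)
  (fun c c' => lorentz_tail_decreasing U c c' HU)).
lapply A; clear A; [intros A|].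
2:{ intros k. pose proof (pos_INR k). split; nra. }
lapply A; clear A; [intros A|].
2:{ intros k. rewrite S_INR. nra. }
lapply B; clear B; [intros B|].
2:{ intros k. pose proof (pos_INR k). split; nra. }
lapply B; clear B; [intros B|].
2:{ intros k. rewrite S_INR. nra. }
replace (rsum (pole_diff (lorentz_tail U) v) n) with
  (rsum (fun k => lorentz_tail U (PI / 2 - v + 2 * PI * INR k)
                  - lorentz_tail U (PI / 2 + 2 * PI * INR k)) n
   - rsum (fun k => lorentz_tail U (2 * PI * (INR k + 1) - PI / 2)
       - lorentz_tail U (2 * PI * (INR k + 1) - (PI / 2 - v))) n).
- apply Rabs_le. lra.
- rewrite <- rsum_minus. apply rsum_ext. intros k _.
  unfold pole_diff, pole_pair. ring.
Qed.

(** The first error vanishes as [n] grows with [U] fixed, the second as [U] grows; the limits are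
    taken in this order. *)
Lemma gen_integral_poles (n : nat) (v U : R) :
  0 < v < PI / 2 -> 0 < U <= 2 ^ n ->
  Rabs (RInt (gen_kernel (sin v)) 0 U
        - rsum (pole_diff (fun c => PI / c) v) (2 ^ n))
  <= 18 * U / 2 ^ n + 2 / U.
Proof.
intros Hv HU.
pose proof (gen_integral_approx n v U Hv HU) as A.
pose proof (pole_diff_tail (2 ^ n) v U Hv (proj1 HU)) as B.
assert (E : rsum (pole_diff (lorentz_int U) v) (2 ^ n)
  = rsum (pole_diff (fun c => PI / c) v) (2 ^ n)
    - rsum (pole_diff (lorentz_tail U) v) (2 ^ n)).
{ rewrite <- rsum_minus. apply rsum_ext. intros k _.
  unfold pole_diff, pole_pair.
  destruct (pole_positions v k ltac:(lra)) as [p1 p2].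
  destruct (pole_positions 0 k ltac:(lra)) as [p3 p4].
  rewrite Rminus_0_r in p3, p4.
  rewrite !lorentz_int_tail by (lra || assumption). ring. }
rewrite E in A. apply Rabs_le_between in A. apply Rabs_le_between in B.
apply Rabs_le. lra.
Qed.

(** * Expansion in powers of the shift *)

(** Coefficient of [w^k] in [1 / (j + 1/2 - (-1)^j w)]. The sign is written as a [j]-th power so
    that the sum over [j] is a Lerch series with [q = (-1)^k]. *)
Definition lerch_term (k j : nat) : R := ((-1) ^ k) ^ j / (INR j + / 2) ^ S k.

Lemma half_shift_pos (j : nat) : / 2 <= INR j + / 2.
Proof. pose proof (pos_INR j). lra. Qed.

Lemma sum_inv_sqr_bound (n : nat) :
  rsum (fun j => / (INR j + / 2) ^ 2) n <= 5.
Proof.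
(* The strengthened bound telescopes because [(n + 3/2)^2 >= (n + 1) (n + 2)]; the constant 5 makes
   it an equality at the first term, which is 4. *)
cut (rsum (fun j => / (INR j + / 2) ^ 2) (S n) <= 5 - / (INR n + 1)).
{ intros H. pose proof (half_shift_pos n) as P. pose proof (pos_INR n).
  assert (0 < / (INR n + / 2) ^ 2) by (apply Rinv_0_lt_compat, pow_lt; lra).
  assert (0 < / (INR n + 1)) by (apply Rinv_0_lt_compat; lra).
  cbn [rsum] in H. lra. }
induction n as [|n IH].
- cbn [rsum]. simpl INR. lra.
- change (rsum (fun j => / (INR j + / 2) ^ 2) (S (S n)))
    with (rsum (fun j => / (INR j + / 2) ^ 2) (S n) + / (INR (S n) + / 2) ^ 2).
  rewrite S_INR. pose proof (pos_INR n).
  assert (/ (INR n + 1 + / 2) ^ 2 <= / ((INR n + 1) * (INR n + 2)))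
    by (apply Rinv_le_contravar; nra).
  assert (/ ((INR n + 1) * (INR n + 2)) = / (INR n + 1) - / (INR n + 2))
    by (field; lra).
  replace (INR n + 1 + 1) with (INR n + 2) by ring. lra.
Qed.

Lemma ex_series_inv_sqr : ex_series (fun j => / (INR j + / 2) ^ 2).
Proof.
destruct (ex_finite_lim_seq_incr
  (sum_n (fun j => / (INR j + / 2) ^ 2)) 5) as [l Hl].
- intros n. rewrite sum_Sn. unfold plus; simpl.
  pose proof (half_shift_pos (S n)) as P.
  assert (0 < / (INR (S n) + / 2) ^ 2) by (apply Rinv_0_lt_compat, pow_lt; lra).
  cbn in *. lra.
- intros n. rewrite sum_n_rsum. apply sum_inv_sqr_bound.
- exists l. exact Hl.
Qed.

Lemma Rabs_lerch_term (k j : nat) :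
  Rabs (lerch_term (S k) j) <= 2 ^ k * / (INR j + / 2) ^ 2.
Proof.
unfold lerch_term. pose proof (half_shift_pos j) as P.
set (a := INR j + / 2) in *.
assert (Ha : 0 < a ^ S (S k)) by (apply pow_lt; lra).
unfold Rdiv. rewrite Rabs_mult, <- pow_mult, pow_1_abs, Rmult_1_l.
rewrite Rabs_pos_eq by (left; now apply Rinv_0_lt_compat).
replace (a ^ S (S k)) with (a ^ k * a ^ 2) by (simpl; ring).
rewrite Rinv_mult. apply Rmult_le_compat_r.
- left. apply Rinv_0_lt_compat, pow_lt. lra.
- replace (2 ^ k) with (/ (/ 2) ^ k)
    by (rewrite <- pow_inv, Rinv_inv; reflexivity).
  apply Rinv_le_contravar; [apply pow_lt; lra|]. apply pow_incr. lra.
Qed.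

Lemma ex_series_lerch_term (k : nat) : ex_series (lerch_term (S k)).
Proof.
apply (ex_series_le (V := R_CompleteNormedModule) _
  (fun j => 2 ^ k * / (INR j + / 2) ^ 2)).
- intros j. apply Rabs_lerch_term.
- apply (ex_series_scal (V := R_NormedModule) (2 ^ k)), ex_series_inv_sqr.
Qed.

(** Taken along [2 * 2^n] because [2^n] pole pairs produce that many terms. *)
Lemma is_lim_seq_lerch (k : nat) :
  is_lim_seq (fun n => rsum (lerch_term (S k)) (2 * 2 ^ n))
    (Series (lerch_term (S k))).
Proof.
apply is_lim_seq_ext
  with (fun n => sum_n (lerch_term (S k)) (Nat.pred (2 * 2 ^ n))).
- intros n. rewrite sum_n_rsum. f_equal.
  pose proof (Nat.pow_nonzero 2 n). lia.
- apply (is_lim_seq_subseq (sum_n (lerch_term (S k)))).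
  + apply eventually_subseq. intros n. simpl.
    pose proof (Nat.pow_nonzero 2 n). lia.
  + apply Series_correct, ex_series_lerch_term.
Qed.

(** After division by [PI], pair [k] gives the terms [j = 2 k] and [j = 2 k + 1]. The shift moves
    the reflected pole the other way, hence the sign [(-1)^j]. *)
Lemma pole_diff_alternating (v : R) (n : nat) :
  rsum (pole_diff (fun c => PI / c) v) n
  = rsum (fun j => / (INR j + / 2 - (-1) ^ j * (v / PI)) - / (INR j + / 2))
      (2 * n).
Proof.
rewrite rsum_pairs. apply rsum_ext. intros k _.
pose proof PI_neq0 as HPI.
rewrite plus_INR, pow_add, pow_1_even, mult_INR. simpl INR.
unfold pole_diff, pole_pair.
assert (D : forall a b, a = PI * b -> PI / a = / b).
{ intros a b ->. unfold Rdiv.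
  rewrite Rinv_mult, <- Rmult_assoc, Rinv_r, Rmult_1_l; trivial. }
rewrite (D (PI / 2 - v + 2 * PI * INR k)
  (2 * INR k + / 2 - 1 * (v / PI))) by (field; trivial).
rewrite (D (2 * PI * (INR k + 1) - (PI / 2 - v))
  (2 * INR k + 1 + / 2 - 1 * (-1) ^ 1 * (v / PI))) by (field; trivial).
rewrite (D (PI / 2 + 2 * PI * INR k) (2 * INR k + / 2)) by field.
rewrite (D (2 * PI * (INR k + 1) - PI / 2) (2 * INR k + 1 + / 2)) by field.
change (1 + 1) with 2. ring.
Qed.

Lemma geometric_remainder (a s w : R) (K : nat) :
  a <> 0 -> a - s * w <> 0 ->
  / (a - s * w) - / a
  = rsum (fun k => w ^ S k * (s ^ S k / a ^ S (S k))) K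
    + w ^ S K * (s ^ S K / a ^ S K * / (a - s * w)).
Proof.
intros Ha Hd. induction K as [|K IH].
- simpl. field. split; trivial.
- rewrite IH. simpl rsum. rewrite Rplus_assoc. f_equal.
  simpl. field. repeat split; trivial. now apply pow_nonzero.
Qed.

(** With [a = j + 1/2 >= 1/2] and [w <= 1/3] the denominators stay above [a / 3], so the geometric
    remainder of term [j] is at most [3 * 2^K w^(K+1) / a^2]. The sum of the [1 / a^2] is at most 5,
    uniformly in [N]. *)
Lemma pole_series_taylor (w : R) (K N : nat) :
  0 <= w <= / 3 -> (1 <= K)%nat ->
  Rabs (rsum (fun j => / (INR j + / 2 - (-1) ^ j * w) - / (INR j + / 2)) N
        - rsum (fun k => w ^ S k * rsum (lerch_term (S k)) N) K)
  <= 15 * 2 ^ K * w ^ S K.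
Proof.
intros Hw HK.
assert (Hs : forall j, -1 <= (-1) ^ j <= 1).
{ intros j. apply Rabs_le_between. rewrite pow_1_abs. lra. }
assert (Hd : forall j, (INR j + / 2) / 3 <= INR j + / 2 - (-1) ^ j * w).
{ intros j. pose proof (half_shift_pos j). pose proof (Hs j). nra. }
rewrite (rsum_ext (fun k => w ^ S k * rsum (lerch_term (S k)) N)
  (fun k => rsum (fun j => w ^ S k * lerch_term (S k) j) N))
  by (intros k _; now rewrite rsum_scal).
rewrite rsum_swap, <- rsum_minus.
apply Rle_trans with (1 := rsum_Rabs _ _).
apply Rle_trans
  with (rsum (fun j => 3 * 2 ^ K * w ^ S K * / (INR j + / 2) ^ 2) N).
- apply rsum_le. intros j _.
  pose proof (half_shift_pos j) as P. specialize (Hd j).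
  rewrite (geometric_remainder _ _ _ K) by lra.
  match goal with |- Rabs (?x + ?y - ?z) <= _ =>
    replace (x + y - z) with y end.
  2:{ match goal with |- ?y = ?x + ?y - ?z => replace z with x end; [ring|].
      apply rsum_ext. intros k _. unfold lerch_term.
      rewrite <- !pow_mult, (Nat.mul_comm j). reflexivity. }
  pose proof (Rabs_lerch_term K j) as L. unfold lerch_term in L.
  set (a := INR j + / 2) in *.
  assert (Ha : 0 < a ^ S K) by (apply pow_lt; lra).
  rewrite Rabs_mult, (Rabs_pos_eq (w ^ S K)) by (apply pow_le; lra).
  replace (3 * 2 ^ K * w ^ S K * / a ^ 2)
    with (w ^ S K * (3 * (2 ^ K * / a ^ 2))) by ring.
  apply Rmult_le_compat_l; [apply pow_le; lra|].
  apply Rle_trans with (2 := Rmult_le_compat_l 3 _ _ ltac:(lra) L).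
  unfold Rdiv. rewrite !Rabs_mult, <- !pow_mult, !pow_1_abs, !Rmult_1_l.
  rewrite !Rabs_pos_eq; try (left; apply Rinv_0_lt_compat; try apply pow_lt; lra).
  replace (3 * / a ^ S (S K)) with (/ a ^ S K * / (a / 3))
    by (simpl; field; split; [apply pow_nonzero|]; lra).
  apply Rmult_le_compat_l.
  + left. now apply Rinv_0_lt_compat.
  + apply Rinv_le_contravar; lra.
- rewrite rsum_scal.
  replace (15 * 2 ^ K * w ^ S K) with (3 * 2 ^ K * w ^ S K * 5) by ring.
  apply Rmult_le_compat_l; [|apply sum_inv_sqr_bound].
  apply Rmult_le_pos; [|apply pow_le; lra].
  apply Rmult_le_pos; [lra|apply pow_le; lra].
Qed.

Lemma is_lim_seq_rsum (f : nat -> nat -> R) (l : nat -> R) (K : nat) :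
  (forall k, is_lim_seq (f k) (l k)) ->
  is_lim_seq (fun n => rsum (fun k => f k n) K) (rsum l K).
Proof.
intros H. induction K as [|K IH]; simpl.
- apply is_lim_seq_const.
- now apply is_lim_seq_plus'.
Qed.

(** The limit in [n] at fixed [U]: the condition [U <= 2^n] holds eventually, and [v <= 1] puts
    [v / PI] below [1/3]. *)
Lemma gen_integral_taylor (v U : R) (K : nat) :
  0 < v <= 1 -> 0 < U -> (1 <= K)%nat ->
  Rabs (RInt (gen_kernel (sin v)) 0 U
        - rsum (fun k => (v / PI) ^ S k * Series (lerch_term (S k))) K)
  <= 2 / U + 15 * 2 ^ K * (v / PI) ^ S K.
Proof.
intros Hv HU HK. pose proof PI2_3_2 as HPI.
set (G := RInt (gen_kernel (sin v)) 0 U).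
set (w := v / PI).
assert (Hw : 0 <= w <= / 3).
{ unfold w. split; [apply Rdiv_le_0_compat; lra|].
  apply Rmult_le_reg_r with PI; [lra|]. unfold Rdiv.
  rewrite Rmult_assoc, Rinv_l by lra. lra. }
set (Z := fun n => rsum (fun k => w ^ S k
            * rsum (lerch_term (S k)) (2 * 2 ^ n)) K).
assert (LZ : is_lim_seq Z
  (rsum (fun k => w ^ S k * Series (lerch_term (S k))) K)).
{ unfold Z. apply (is_lim_seq_rsum
    (fun k n => w ^ S k * rsum (lerch_term (S k)) (2 * 2 ^ n))).
  intros k. apply (is_lim_seq_scal_l _ _ (Series (lerch_term (S k)))).
  apply is_lim_seq_lerch. }
assert (L1 : is_lim_seq (fun n => Rabs (G - Z n))
  (Rabs (G - rsum (fun k => w ^ S k * Series (lerch_term (S k))) K))).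
{ apply (is_lim_seq_abs _ (G - _)). apply is_lim_seq_minus'; [|exact LZ].
  apply is_lim_seq_const. }
assert (Lp : is_lim_seq (fun n => / 2 ^ n) 0).
{ apply is_lim_seq_ext with (fun n => (/ 2) ^ n).
  - intros n. apply pow_inv.
  - apply is_lim_seq_geom. rewrite Rabs_pos_eq; lra. }
assert (L2 : is_lim_seq
  (fun n => 18 * U * / 2 ^ n + (2 / U + 15 * 2 ^ K * w ^ S K))
  (18 * U * 0 + (2 / U + 15 * 2 ^ K * w ^ S K))).
{ apply is_lim_seq_plus'; [|apply is_lim_seq_const].
  apply (is_lim_seq_scal_l _ (18 * U) 0), Lp. }
rewrite Rmult_0_r, Rplus_0_l in L2.
refine (is_lim_seq_le_loc _ _ _ _ _ L1 L2).
destruct (INR_unbounded U) as [n0 Hn0].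
exists n0. intros n Hn.
assert (Hpow : U <= 2 ^ n).
{ apply Rle_trans with (INR n0); [lra|].
  apply Rle_trans with (INR n); [now apply le_INR|].
  clear. induction n as [|n IH]; [simpl; lra|].
  rewrite S_INR. simpl. assert (1 <= 2 ^ n) by (apply pow_R1_Rle; lra). lra. }
pose proof (gen_integral_poles n v U ltac:(lra) (conj HU Hpow)) as A.
rewrite pole_diff_alternating in A.
pose proof (pole_series_taylor w K (2 * 2 ^ n) Hw HK) as B.
fold G in A. fold w in A. fold (Z n) in B.
apply Rabs_le_between in A. apply Rabs_le_between in B. apply Rabs_le.
change (18 * U * / 2 ^ n) with (18 * U / 2 ^ n).
lra.
Qed.

(** * Coefficients of arcsine powers and Chebyshev polynomials *)

(** Taylor coefficients of [f = (1 - x^2)^(-1/2)], by the recursion that [(1 - x^2) f' = x f]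
    imposes. *)
Fixpoint inv_sqrt_coef (n : nat) : R :=
  match n with
  | O => 1
  | S O => 0
  | S (S k) => (INR k + 1) / (INR k + 2) * inv_sqrt_coef k
  end.

Lemma pair_induction (P : nat -> Prop) :
  P 0%nat -> P 1%nat -> (forall n, P n -> P (S (S n))) -> forall n, P n.
Proof.
intros H0 H1 HS n. enough (P n /\ P (S n)) by tauto.
induction n as [|n [IH1 IH2]]; auto.
Qed.

Lemma inv_sqrt_coef_bounds (n : nat) : 0 <= inv_sqrt_coef n <= 1.
Proof.
induction n as [| |n IH] using pair_induction; [simpl; lra|simpl; lra|].
cbn [inv_sqrt_coef]. pose proof (pos_INR n).
assert (0 <= (INR n + 1) / (INR n + 2) <= 1); [|nra].
split; [apply Rdiv_le_0_compat; lra|].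
apply Rmult_le_reg_r with (INR n + 2); [lra|].
unfold Rdiv. rewrite Rmult_assoc, Rinv_l; lra.
Qed.

Lemma inv_sqrt_coef_odd (n : nat) : Nat.odd n = true -> inv_sqrt_coef n = 0.
Proof.
induction n as [| |n IH] using pair_induction; intros H.
- discriminate.
- reflexivity.
- cbn [inv_sqrt_coef]. rewrite IH by exact H. ring.
Qed.

Lemma inv_sqrt_radius (x : R) :
  Rabs x < 1 -> Rbar_lt (Rabs x) (CV_radius inv_sqrt_coef).
Proof.
intros Hx. apply Rbar_lt_le_trans with (Finite 1); [exact Hx|].
apply (CV_radius_bounded inv_sqrt_coef). exists 1. intros n.
rewrite pow1, Rmult_1_r. pose proof (inv_sqrt_coef_bounds n).
rewrite Rabs_pos_eq; lra.
Qed.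

Lemma constant_of_derive (f : R -> R) :
  (forall x, Rabs x < 1 -> is_derive f x 0) ->
  forall x, Rabs x < 1 -> f x = f 0.
Proof.
intros H x Hx. apply Rabs_def2 in Hx.
destruct (Rtotal_order x 0) as [h|[->|h]]; [|reflexivity|].
- apply (eq_is_derive (V := R_NormedModule)); [|exact h].
  intros t Ht. apply H, Rabs_def1; lra.
- symmetry. apply (eq_is_derive (V := R_NormedModule)); [|exact h].
  intros t Ht. apply H, Rabs_def1; lra.
Qed.

Lemma inv_sqrt_ode (x : R) : Rabs x < 1 ->
  (1 - x ^ 2) * PSeries (PS_derive inv_sqrt_coef) x
  = x * PSeries inv_sqrt_coef x.
Proof.
intros Hx.
assert (R0 := inv_sqrt_radius x Hx).
assert (R1 : Rbar_lt (Rabs x) (CV_radius (PS_derive inv_sqrt_coef)))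
  by (rewrite CV_radius_derive; exact R0).
apply CV_radius_inside in R0. apply CV_radius_inside in R1.
assert (E : PSeries (PS_derive inv_sqrt_coef) x
  = PSeries (PS_plus (PS_incr_1 inv_sqrt_coef)
      (PS_incr_1 (PS_incr_1 (PS_derive inv_sqrt_coef)))) x).
{ apply PSeries_ext. intros n.
  unfold PS_plus, PS_incr_1, PS_derive, plus, zero.
  destruct n as [|[|n]].
  - simpl. ring.
  - simpl. field.
  - change (INR (S (S (S n)))
              * ((INR (S n) + 1) / (INR (S n) + 2) * inv_sqrt_coef (S n))
            = inv_sqrt_coef (S n) + INR (S n) * inv_sqrt_coef (S n)).
    rewrite !S_INR. pose proof (pos_INR n). field. lra. }
rewrite PSeries_plus in E.
- rewrite !PSeries_incr_1 in E. lra.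
- now apply ex_pseries_incr_1.
- now apply ex_pseries_incr_1, ex_pseries_incr_1.
Qed.

(** By the differential equation the product of the series with [sqrt (1 - x^2)] has derivative 0,
    and it is 1 at the origin. *)
Lemma PSeries_inv_sqrt (x : R) :
  Rabs x < 1 -> PSeries inv_sqrt_coef x = / sqrt (1 - x ^ 2).
Proof.
intros Hx.
assert (Hp : forall y, Rabs y < 1 -> 0 < 1 - y ^ 2)
  by (intros y Hy; apply Rabs_def2 in Hy; nra).
assert (C := constant_of_derive
  (fun y => PSeries inv_sqrt_coef y * sqrt (1 - y ^ 2))).
lapply C; clear C; [intros C|].
- specialize (C x Hx). simpl in C. rewrite PSeries_0 in C.
  replace (1 - 0 * (0 * 1)) with 1 in C by ring.
  rewrite sqrt_1 in C. simpl in C.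
  pose proof (sqrt_lt_R0 _ (Hp x Hx)) as S. simpl in S.
  apply Rmult_eq_reg_r with (sqrt (1 - x * (x * 1))); [|lra].
  simpl. rewrite C, Rinv_l; lra.
- intros y Hy. specialize (Hp y Hy).
  pose proof (sqrt_lt_R0 _ Hp) as S.
  pose proof (is_derive_PSeries _ _ (inv_sqrt_radius y Hy)) as D.
  assert (D2 : is_derive (fun y => sqrt (1 - y ^ 2)) y
                 (- y / sqrt (1 - y ^ 2))).
  { auto_derive; [simpl in Hp; exact Hp|].
    simpl in *. change (1 + - (y * (y * 1))) with (1 - y * (y * 1)).
    field. lra. }
  pose proof (is_derive_mult _ _ y _ _ D D2 Rmult_comm) as DM.
  simpl in DM. unfold plus, mult in DM; simpl in DM.
  evar_last; [exact DM|].
  pose proof (inv_sqrt_ode y Hy) as O.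
  simpl in *. set (s := sqrt (1 - y * (y * 1))) in *.
  assert (Es : s * s = 1 - y * (y * 1)) by (apply sqrt_sqrt; lra).
  rewrite <- Es in O.
  apply Rmult_eq_reg_r with s; [|lra].
  rewrite Rmult_plus_distr_r. unfold Rdiv.
  replace (PSeries inv_sqrt_coef y * (- y * / s) * s)
    with (- (y * PSeries inv_sqrt_coef y)) by (field; lra).
  rewrite <- O. ring.
Qed.

Lemma is_derive_asin (x : R) :
  Rabs x < 1 -> is_derive asin x (/ sqrt (1 - x ^ 2)).
Proof.
intros Hx. apply Rabs_def2 in Hx.
assert (Hx' : -1 < x < 1) by lra.
apply is_derive_Reals.
assert (H := derive_pt_asin x Hx').
pose proof (derive_pt_eq_1 _ _ _ _ H) as D.
unfold Rdiv in D. rewrite Rmult_1_l in D.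
replace (x ^ 2) with (x²) by (unfold Rsqr; ring). exact D.
Qed.

Definition asin_coef : nat -> R := PS_Int inv_sqrt_coef.

Lemma PSeries_asin (x : R) : Rabs x < 1 -> PSeries asin_coef x = asin x.
Proof.
intros Hx.
assert (C := constant_of_derive (fun y => PSeries asin_coef y - asin y)).
lapply C; clear C; [intros C|].
- specialize (C x Hx). simpl in C. rewrite PSeries_0, asin_0 in C.
  unfold asin_coef at 2 in C. simpl in C. lra.
- intros y Hy.
  assert (R0 : Rbar_lt (Rabs y) (CV_radius asin_coef))
    by (unfold asin_coef; rewrite CV_radius_Int; now apply inv_sqrt_radius).
  pose proof (is_derive_PSeries _ _ R0) as D.
  replace (PSeries (PS_derive asin_coef) y) with (/ sqrt (1 - y ^ 2)) in D.
  + pose proof (is_derive_minus _ _ _ _ _ D (is_derive_asin y Hy)) as DM.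
    evar_last; [exact DM|]. unfold minus, plus, opp; simpl. ring.
  + rewrite <- PSeries_inv_sqrt by exact Hy. apply PSeries_ext.
    intros n. unfold PS_derive, asin_coef, PS_Int.
    rewrite S_INR. pose proof (pos_INR n). field. lra.
Qed.

Fixpoint asin_pow_coef (k : nat) : nat -> R :=
  match k with
  | O => fun n => match n with O => 1 | S _ => 0 end
  | S k' => PS_mult asin_coef (asin_pow_coef k')
  end.

Lemma radius_ge_1 (a : nat -> R) :
  (forall x, Rabs x < 1 -> ex_pseries a x) ->
  forall x, Rabs x < 1 -> Rbar_lt (Rabs x) (CV_radius a).
Proof.
intros H x Hx.
set (y := (Rabs x + 1) / 2).
assert (Hy : Rabs y = y) by (apply Rabs_pos_eq; unfold y;
  pose proof (Rabs_pos x); lra).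
apply Rbar_lt_le_trans with (Finite (Rabs y)).
- rewrite Hy. simpl. unfold y. lra.
- apply Rbar_not_lt_le. intros Hlt. apply (CV_disk_outside _ _ Hlt).
  apply ex_series_lim_0, ex_pseries_R, H. rewrite Hy. unfold y. lra.
Qed.

Lemma is_series_zero : is_series (fun _ : nat => 0) 0.
Proof.
apply (filterlim_ext (fun _ => 0)).
- intros n. rewrite sum_n_const. ring.
- apply filterlim_const.
Qed.

Lemma is_pseries_asin_pow (k : nat) :
  forall x, Rabs x < 1 -> is_pseries (asin_pow_coef k) x (asin x ^ k).
Proof.
induction k as [|k IH]; intros x Hx.
- simpl. apply is_pseries_R.
  apply (is_series_decr_1 (V := R_NormedModule)).
  apply (eq_ind 0 (fun l => is_series _ l)).
  + apply is_series_ext with (fun _ => 0); [|exact is_series_zero].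
    intros n. simpl. ring.
  + simpl. unfold plus, opp; simpl. ring.
- simpl. apply is_pseries_mult; try apply IH; trivial.
  + rewrite <- PSeries_asin by exact Hx.
    apply PSeries_correct, CV_radius_inside.
    unfold asin_coef. rewrite CV_radius_Int. now apply inv_sqrt_radius.
  + unfold asin_coef. rewrite CV_radius_Int. now apply inv_sqrt_radius.
  + apply radius_ge_1; [|exact Hx]. intros y Hy. eexists. now apply IH.
Qed.

Lemma asin_coef_even (n : nat) : Nat.odd n = false -> asin_coef n = 0.
Proof.
destruct n as [|n]; intros H; [reflexivity|].
unfold asin_coef, PS_Int. rewrite inv_sqrt_coef_odd.
- unfold Rdiv. ring.
- rewrite Nat.odd_succ in H. unfold Nat.odd. now rewrite H.
Qed.

(** [asin] is odd, so its [k]-th power has the parity of [k]. *)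
Lemma asin_pow_coef_parity (k n : nat) :
  Nat.odd (n + k) = true -> asin_pow_coef k n = 0.
Proof.
revert n. induction k as [|k IH]; intros n H; simpl.
- destruct n; [discriminate|reflexivity].
- unfold PS_mult. apply sum_eq_R0. intros i Hi.
  destruct (Nat.odd i) eqn:Ei.
  + rewrite (IH (n - i)%nat); [ring|].
    replace (n + S k)%nat with (i + (n - i + k) + 1)%nat in H by lia.
    rewrite !Nat.odd_add, Ei in H. rewrite !Nat.odd_add.
    simpl in H. destruct (Nat.odd (n - i)), (Nat.odd k); simpl in *; trivial.
  + rewrite asin_coef_even by exact Ei. ring.
Qed.

(** Multiplication by the variable, for the Chebyshev recurrence; it also places [moment i] in
    degree [i + 1]. *)
Definition coef_shift (b : nat -> R) (i : nat) : R :=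
  match i with O => 0 | S j => b j end.

Lemma rsum_coef_shift (b : nat -> R) (x : R) (N : nat) :
  rsum (fun i => coef_shift b i * x ^ i) (S N)
  = x * rsum (fun i => b i * x ^ i) N.
Proof.
rewrite rsum_S_l. cbn [coef_shift]. rewrite <- rsum_scal.
rewrite Rmult_0_l, Rplus_0_l. apply rsum_ext. intros k _. simpl. ring.
Qed.

(* The upper bound [N] of the sum is arbitrary above [m], so [b] vanishes beyond
   the degree. *)
Definition chebU_coefs (m : nat) (b : nat -> R) : Prop :=
  (forall x N, (m < N)%nat ->
     ChebyshevU m x = rsum (fun i => b i * x ^ i) N) /\
  (forall i, Nat.odd (i + m) = true -> b i = 0).

Lemma chebU_coefs_exist (m : nat) : exists b, chebU_coefs m b.
Proof.
enough ((exists b, chebU_coefs m b) /\ (exists b, chebU_coefs (S m) b)) by tauto.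
(* The coefficients of the zeroth power of [asin] are reused as those of the constant polynomial
   1. *)
assert (Z : forall x N, rsum (fun i => asin_pow_coef 0 i * x ^ i) (S N) = 1).
{ intros x N. rewrite rsum_S_l. rewrite rsum_zero; [simpl; ring|].
  intros k _. simpl. ring. }
induction m as [|m [IH1 [b [Hb Pb]]]].
- split.
  + exists (asin_pow_coef 0). split.
    * intros x [|N] HN; [lia|]. now rewrite Z.
    * intros i Hi. now apply asin_pow_coef_parity.
  + exists (fun i => 2 * coef_shift (asin_pow_coef 0) i). split.
    * intros x [|[|N]] HN; [lia|lia|].
      rewrite (rsum_ext _ (fun i => 2 * (coef_shift (asin_pow_coef 0) i * x ^ i)))
        by (intros; ring).
      rewrite rsum_scal, rsum_coef_shift, Z. simpl. ring.
    * intros [|i] Hi; cbn [coef_shift]; [ring|].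
      rewrite (asin_pow_coef_parity 0 i); [ring|].
      rewrite Nat.add_succ_l, Nat.add_succ_r, Nat.odd_succ_succ in Hi. exact Hi.
- split; [exists b; now split|].
  destruct IH1 as [b0 [Hb0 Pb0]].
  exists (fun i => 2 * coef_shift b i - b0 i). split.
  + intros x [|N] HN; [lia|].
    rewrite (rsum_ext _ (fun i => 2 * (coef_shift b i * x ^ i) - b0 i * x ^ i))
      by (intros; ring).
    rewrite rsum_minus, rsum_scal, rsum_coef_shift.
    rewrite <- Hb, <- Hb0 by lia.
    change (ChebyshevU (S (S m)) x)
      with (2 * x * ChebyshevU (S m) x - ChebyshevU m x). ring.
  + intros i Hi.
    rewrite (Pb0 i) by (rewrite !Nat.add_succ_r, Nat.odd_succ_succ in Hi; exact Hi).
    destruct i as [|i]; cbn [coef_shift]; [ring|].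
    rewrite (Pb i); [ring|].
    rewrite Nat.add_succ_l, Nat.add_succ_r, Nat.odd_succ_succ in Hi. exact Hi.
Qed.

(** The monomial [b i * x^(-i)] contributes to [x^z] the coefficient of [x^(z+i)] in [asin^k], and
    nothing when [z + i] is negative. The principal part has order at most [m]. *)
Lemma is_laurent_chebU_asin (m k : nat) (b : nat -> R) :
  chebU_coefs m b ->
  is_laurent (fun x => ChebyshevU m (1 / x) * asin x ^ k)
    (fun z => rsum (fun i => b i *
       (if (z + Z.of_nat i <? 0)%Z then 0
        else asin_pow_coef k (Z.to_nat (z + Z.of_nat i)))) (S m)).
Proof.
intros [Hb _]. exists m. split.
- intros z Hz. apply rsum_zero. intros i Hi.
  replace (z + Z.of_nat i <? 0)%Z with true; [ring|].
  symmetry. apply Z.ltb_lt. lia.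
- exists (mkposreal 1 Rlt_0_1). intros x Hx Hx0.
  assert (Hx1 : Rabs x < 1).
  { unfold ball in Hx; simpl in Hx.
    unfold AbsRing_ball, abs, minus, plus, opp in Hx; simpl in Hx.
    now rewrite Ropp_0, Rplus_0_r in Hx. }
  rewrite (Hb (1 / x) (S m)) by lia.
  replace (rsum (fun i => b i * (1 / x) ^ i) (S m) * asin x ^ k)
    with (rsum (fun i => b i * ((/ x) ^ i * asin x ^ k)) (S m)).
  2:{ rewrite Rmult_comm, <- rsum_scal. apply rsum_ext. intros i _.
      unfold Rdiv. rewrite Rmult_1_l. ring. }
  set (t := fun i j : nat => b i * ((if (Z.of_nat j - Z.of_nat m
              + Z.of_nat i <? 0)%Z then 0
          else asin_pow_coef k (Z.to_nat (Z.of_nat j - Z.of_nat m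
              + Z.of_nat i))) * powerRZ x (Z.of_nat j - Z.of_nat m))).
  apply is_series_ext with (fun j => rsum (fun i => t i j) (S m)).
  { intros j. unfold t. rewrite Rmult_comm, <- rsum_scal.
    apply rsum_ext. intros i _. ring. }
  assert (Ht : forall i, (i < S m)%nat ->
    is_series (t i) (b i * ((/ x) ^ i * asin x ^ k))).
  { intros i Hi. unfold t.
    apply (is_series_scal (V := R_NormedModule) (b i)).
    (* Writing [x^(-i)] as [x^(-m) * x^(m-i)] gives all monomials the common offset [m], with a
       nonnegative shift [m - i] of the power series. *)
    pose proof (is_pseries_asin_pow k x Hx1) as P.
    apply (is_pseries_incr_n _ (m - i)) in P. apply is_pseries_R in P.
    apply (is_series_scal (V := R_NormedModule) (powerRZ x (- Z.of_nat m)))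
      in P.
    replace ((/ x) ^ i * asin x ^ k) with
      (scal (powerRZ x (- Z.of_nat m))
         (scal (pow_n x (m - i)) (asin x ^ k))).
    - refine (is_series_ext _ _ _ _ P). intros j.
      rewrite PS_incr_n_simplify.
      unfold Z.sub at 3. rewrite powerRZ_add, <- pow_powerRZ by exact Hx0.
      unfold scal; simpl; unfold mult; simpl.
      destruct (Compare_dec.le_lt_dec (m - i) j) as [h|h].
      + replace (Z.of_nat j - Z.of_nat m + Z.of_nat i <? 0)%Z with false
          by (symmetry; apply Z.ltb_ge; lia).
        replace (Z.to_nat (Z.of_nat j - Z.of_nat m + Z.of_nat i))
          with (j - (m - i))%nat by lia.
        ring.
      + replace (Z.of_nat j - Z.of_nat m + Z.of_nat i <? 0)%Z with true
          by (symmetry; apply Z.ltb_lt; lia).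
        unfold zero; simpl. ring.
    - rewrite pow_n_pow, powerRZ_neg', <- pow_powerRZ.
      unfold scal; simpl; unfold mult; simpl.
      rewrite <- Rmult_assoc. f_equal.
      rewrite pow_inv.
      replace (x ^ m) with (x ^ (m - i) * x ^ i)
        by (rewrite <- pow_add; f_equal; lia).
      field. split; now apply pow_nonzero. }
  clear - Ht. induction (S m) as [|p IH]; simpl.
  + exact is_series_zero.
  + apply (is_series_plus (V := R_NormedModule)
      (fun j => rsum (fun i => t i j) p) (t p)).
    * apply IH. intros i Hi. apply Ht. lia.
    * apply Ht. lia.
Qed.

(** In degree 1 the monomial of index [i] picks the coefficient of [x^(i+1)], the one that also
    occurs in [moment_eq]. *)
Lemma laurent_coeff_chebU_asin (m k : nat) (b : nat -> R) :
  chebU_coefs m b ->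
  laurent_coeff 1 (fun x => ChebyshevU m (1 / x) * asin x ^ k)
  = rsum (fun i => b i * asin_pow_coef k (S i)) (S m).
Proof.
intros H. rewrite (laurent_coeff_unique _ _ 1 (is_laurent_chebU_asin m k b H)).
apply rsum_ext. intros i _.
replace (1 + Z.of_nat i <? 0)%Z with false by (symmetry; apply Z.ltb_ge; lia).
do 2 f_equal. lia.
Qed.

(** * The integral as a combination of moments *)

(* On [0 < x < PI / 4] this is [- cos (2 * x) / ln (tan x)], extended
   continuously to both endpoints. *)
Definition ln_tan_kernel (x : R) : R :=
  if Rle_dec x 0 then 0 else tanhc (- ln (tan x)).

Lemma tanhc_le_inv (u : R) : 0 < u -> tanhc u <= / u.
Proof.
intros Hu. unfold tanhc. destruct (Req_EM_T u 0); [lra|].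
assert (tanh u <= 1).
{ unfold tanh. pose proof (cosh_ge_1 u).
  apply Rmult_le_reg_r with (cosh u); [lra|].
  unfold Rdiv. rewrite Rmult_assoc, Rinv_l by lra.
  unfold sinh, cosh. pose proof (exp_pos (- u)). lra. }
unfold Rdiv. rewrite <- (Rmult_1_l (/ u)) at 2.
apply Rmult_le_compat_r; [|lra]. left. now apply Rinv_0_lt_compat.
Qed.

Lemma ln_tan_neg (x : R) : 0 < x < PI / 4 -> 0 < tan x /\ ln (tan x) < 0.
Proof.
intros Hx. assert (0 < tan x) by (apply tan_gt_0; lra).
split; [trivial|]. rewrite <- ln_1. apply ln_increasing; [trivial|].
rewrite <- tan_PI4. apply tan_increasing; lra.
Qed.

Lemma ln_tan_nonpos (x : R) : 0 < x <= PI / 4 -> ln (tan x) <= 0.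
Proof.
intros Hx. destruct (Rle_lt_or_eq_dec _ _ (proj2 Hx)) as [h| ->].
- left. apply ln_tan_neg. lra.
- rewrite tan_PI4, ln_1. lra.
Qed.

Lemma ln_tan_kernel_bounds (x : R) :
  0 <= x <= PI / 4 -> 0 <= ln_tan_kernel x <= 1.
Proof.
intros Hx. unfold ln_tan_kernel. destruct (Rle_dec x 0); [lra|].
apply tanhc_bounds. pose proof (ln_tan_nonpos x). lra.
Qed.

Lemma continuous_ln_tan_kernel (x : R) :
  0 <= x <= PI / 4 -> continuous ln_tan_kernel x.
Proof.
intros Hx. pose proof PI_RGT_0 as HPI.
destruct (Rle_lt_or_eq_dec _ _ (proj1 Hx)) as [Hx0| <-].
- apply continuous_ext_loc with (fun y => tanhc (- ln (tan y))).
  + exists (mkposreal _ Hx0). intros y Hy.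
    unfold ball in Hy; simpl in Hy.
    unfold AbsRing_ball, abs, minus, plus, opp in Hy; simpl in Hy.
    apply Rabs_def2 in Hy.
    unfold ln_tan_kernel. destruct (Rle_dec y 0); [lra|reflexivity].
  + apply (continuous_comp (fun y => - ln (tan y)) tanhc);
      [|apply continuous_tanhc].
    assert (0 < cos x) by (apply cos_gt_0; lra).
    assert (0 < tan x) by (apply tan_gt_0; lra).
    apply (ex_derive_continuous (fun y => - ln (tan y))).
    unfold tan in *. auto_derive. split; [lra|]. split; trivial.
- apply filterlim_locally. intros e. pose proof (cond_pos e) as He.
  (* For [0 < y < atan t] one has [- ln (tan y) > 2 / e], so the kernel is at most [e / 2]. *)
  set (t := exp (- (2 / e))).
  assert (Ht : 0 < atan t)
    by (rewrite <- atan_0; apply atan_increasing, exp_pos).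
  assert (Hd : 0 < Rmin (atan t) (PI / 4)) by (apply Rmin_pos; lra).
  exists (mkposreal _ Hd). intros y Hy.
  unfold ball in *; simpl in *.
  unfold AbsRing_ball, abs, minus, plus, opp in *; simpl in *.
  unfold ln_tan_kernel at 2. destruct (Rle_dec 0 0) as [_|]; [|lra].
  rewrite Ropp_0, Rplus_0_r in *.
  unfold ln_tan_kernel. destruct (Rle_dec y 0) as [|Hy0];
    [rewrite Rabs_R0; lra|].
  apply Rabs_def2 in Hy.
  assert (Hy1 : y < atan t) by (apply Rlt_le_trans with (1 := proj1 Hy), Rmin_l).
  assert (Hy2 : y < PI / 4) by (apply Rlt_le_trans with (1 := proj1 Hy), Rmin_r).
  destruct (ln_tan_neg y) as [T1 T2]; [lra|].
  assert (T3 : ln (tan y) < - (2 / e)).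
  { rewrite <- (ln_exp (- (2 / e))). apply ln_increasing; [trivial|].
    fold t. rewrite <- (tan_atan t). pose proof (atan_bound t).
    apply tan_increasing; lra. }
  assert (0 < 2 / e) by (apply Rdiv_lt_0_compat; lra).
  rewrite Rabs_pos_eq by (apply tanhc_bounds; lra).
  apply Rle_lt_trans with (1 := tanhc_le_inv (- ln (tan y)) ltac:(lra)).
  apply Rle_lt_trans with (/ (2 / e)).
  + apply Rinv_le_contravar; lra.
  + replace (/ (2 / e)) with (e / 2) by (field; lra). lra.
Qed.

Lemma tanh_neg_ln_tan (x : R) :
  0 < x < PI / 2 -> tanh (- ln (tan x)) = cos (2 * x).
Proof.
intros Hx.
assert (0 < cos x) by (apply cos_gt_0; lra).
assert (0 < sin x) by (apply sin_gt_0; lra).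
assert (0 < tan x) by (apply tan_gt_0; lra).
unfold tanh, sinh, cosh. rewrite Ropp_involutive, exp_Ropp, exp_ln by trivial.
pose proof (sin2_cos2 x) as E. unfold Rsqr in E.
rewrite cos_2a. unfold tan.
replace (cos x * cos x - sin x * sin x)
  with ((cos x * cos x - sin x * sin x) / (sin x * sin x + cos x * cos x))
  by (rewrite E; field).
field. repeat split; nra.
Qed.

(** [ChebyshevU_cos] at the angle [PI / 2 - 2 x] turns [U_m (sin 2x) cos 2x] into the sine of
    [(m + 1) (PI / 2 - 2 x)]. This angle is [n PI - (PI / 2 + y)], with [y] the argument of the
    cosine in the numerator. *)
Lemma integrand_eq (n eps : nat) (x : R) :
  (1 <= n)%nat -> 0 < x < PI / 4 ->
  cos ((4 * INR n - 2 + 2 * INR eps) * x - PI * INR eps / 2) / ln (tan x)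
  = (-1) ^ n * (ln_tan_kernel x * ChebyshevU (2 * n - 2 + eps) (sin (2 * x))).
Proof.
intros Hn Hx.
destruct (ln_tan_neg x Hx) as [T1 T2].
unfold ln_tan_kernel. destruct (Rle_dec x 0); [lra|].
unfold tanhc. destruct (Req_EM_T (- ln (tan x)) 0); [lra|].
rewrite tanh_neg_ln_tan by lra.
pose proof (ChebyshevU_cos (2 * n - 2 + eps) (PI / 2 - 2 * x)) as C.
rewrite cos_shift, sin_shift in C.
assert (N1 : INR (S (2 * n - 2 + eps)) = 2 * INR n - 1 + INR eps).
{ rewrite S_INR, plus_INR, minus_INR by lia. rewrite mult_INR.
  simpl (INR 2). ring. }
rewrite N1 in C.
set (y := (4 * INR n - 2 + 2 * INR eps) * x - PI * INR eps / 2) in *.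
assert (S : sin ((2 * INR n - 1 + INR eps) * (PI / 2 - 2 * x))
            = - ((-1) ^ n * cos y)).
{ replace ((2 * INR n - 1 + INR eps) * (PI / 2 - 2 * x))
    with (INR n * PI - (PI / 2 + y)) by (unfold y; field).
  assert (SC : sin (INR n * PI) = 0 /\ cos (INR n * PI) = (-1) ^ n).
  { clear. induction n as [|n [IH1 IH2]].
    - simpl. rewrite Rmult_0_l, sin_0, cos_0. split; reflexivity.
    - rewrite S_INR, Rmult_plus_distr_r, Rmult_1_l, neg_sin, neg_cos, IH1, IH2.
      simpl. split; ring. }
  destruct SC as [S1 C1].
  rewrite sin_minus, S1, C1, sin_plus, sin_PI2, cos_PI2. ring. }
rewrite S in C.
assert (sq : (-1) ^ n * (-1) ^ n = 1).
{ rewrite <- pow_add. replace (n + n)%nat with (2 * n)%nat by lia.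
  apply pow_1_even. }
replace ((-1) ^ n * (cos (2 * x) / - ln (tan x)
    * ChebyshevU (2 * n - 2 + eps) (sin (2 * x))))
  with (- ((-1) ^ n * (ChebyshevU (2 * n - 2 + eps) (sin (2 * x))
           * cos (2 * x)) / ln (tan x))) by (field; lra).
rewrite C.
replace ((-1) ^ n * - ((-1) ^ n * cos y)) with (- ((-1) ^ n * (-1) ^ n * cos y))
  by ring.
rewrite sq. field. lra.
Qed.

(* The moment [M_(i+1)], with the substitution undone. *)
Definition moment (i : nat) : R :=
  RInt (fun x => 2 * ln_tan_kernel x * sin (2 * x) ^ i) 0 (PI / 4).

Lemma continuous_kernel_mult (f : R -> R) (x : R) :
  0 <= x <= PI / 4 -> ex_derive f x ->
  continuous (fun x => 2 * ln_tan_kernel x * f x) x.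
Proof.
intros Hx Hf. apply (continuous_mult (fun x => 2 * ln_tan_kernel x) f).
- apply (continuous_scal_r 2 ln_tan_kernel).
  now apply continuous_ln_tan_kernel.
- now apply (ex_derive_continuous f).
Qed.

Lemma is_RInt_moment (i : nat) :
  is_RInt (fun x => 2 * ln_tan_kernel x * sin (2 * x) ^ i) 0 (PI / 4)
    (moment i).
Proof.
apply (RInt_correct (V := R_CompleteNormedModule)).
apply (ex_RInt_continuous (V := R_CompleteNormedModule)).
intros x Hx. pose proof PI_RGT_0.
rewrite Rmin_left, Rmax_right in Hx by lra.
apply (continuous_kernel_mult (fun x => sin (2 * x) ^ i)); [trivial|].
auto_derive. trivial.
Qed.

(** Geometric sum over [i] of [z^(i+1)] times the integrand of [moment i], for [0 <= z < 1]. *)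
Definition gen_integrand (z x : R) : R :=
  2 * ln_tan_kernel x * (z / (1 - z * sin (2 * x))).

Lemma one_sub_sin_pos (z x : R) :
  0 <= z < 1 -> 1 - z <= 1 - z * sin (2 * x).
Proof. intros Hz. pose proof (SIN_bound (2 * x)). nra. Qed.

Lemma continuous_gen_integrand (z x : R) :
  0 <= z < 1 -> 0 <= x <= PI / 4 -> continuous (gen_integrand z) x.
Proof.
intros Hz Hx. pose proof (one_sub_sin_pos z x Hz).
apply (continuous_kernel_mult (fun x => z / (1 - z * sin (2 * x))));
  [trivial|]. auto_derive. lra.
Qed.

Lemma ex_RInt_gen_integrand (z a b : R) :
  0 <= z < 1 -> 0 <= a <= b -> b <= PI / 4 -> ex_RInt (gen_integrand z) a b.
Proof.
intros Hz Ha Hb.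
apply (ex_RInt_continuous (gen_integrand z)). intros x Hx.
rewrite Rmin_left, Rmax_right in Hx by lra.
apply continuous_gen_integrand; lra.
Qed.

Lemma atan_exp_bounds (u : R) : 0 <= u -> 0 < atan (exp (- u)) <= PI / 4.
Proof.
intros Hu. split.
- rewrite <- atan_0. apply atan_increasing, exp_pos.
- rewrite <- atan_1. destruct (Rle_lt_or_eq_dec _ _ Hu) as [h| <-].
  + left. apply atan_increasing. rewrite <- exp_0. apply exp_increasing. lra.
  + rewrite Ropp_0, exp_0. lra.
Qed.

(** Substitution [x = atan (exp (- u))], under which [sin 2x = 1 / cosh u]. It is decreasing, so the
    endpoints are swapped. *)
Lemma gen_kernel_subst (z U : R) :
  0 <= z < 1 -> 0 <= U ->
  RInt (gen_kernel z) 0 U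
  = RInt (gen_integrand z) (atan (exp (- U))) (PI / 4).
Proof.
intros Hz HU.
set (dg := fun u => - exp (- u) / (1 + exp (- u) ^ 2)).
assert (H := RInt_comp (V := R_CompleteNormedModule) (gen_integrand z)
  (fun u => atan (exp (- u))) dg 0 U).
lapply H; clear H; [intros H|].
2:{ intros u Hu. rewrite Rmin_left in Hu by lra.
    pose proof (atan_exp_bounds u (proj1 Hu)).
    apply continuous_gen_integrand; lra. }
lapply H; clear H; [intros H|].
2:{ intros u _. pose proof (exp_pos (- u)). unfold dg. split.
    - auto_derive; [trivial|]. field. nra.
    - apply (ex_derive_continuous (fun u => - exp (- u) / (1 + exp (- u) ^ 2))).
      auto_derive. nra. }
cbv beta in H. rewrite Ropp_0, exp_0, atan_1 in H.
rewrite <- (opp_RInt_swap (gen_integrand z) (atan (exp (- U))) (PI / 4)) in H.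
2:{ pose proof (atan_exp_bounds U HU). apply ex_RInt_gen_integrand; lra. }
rewrite (RInt_ext _ (fun u => opp (gen_kernel z u))) in H.
- rewrite (RInt_opp (V := R_CompleteNormedModule)) in H.
  + unfold opp in H; simpl in H. lra.
  + apply (ex_RInt_continuous (gen_kernel z)). intros u _.
    apply continuous_gen_kernel. lra.
- intros u Hu. rewrite Rmin_left in Hu by lra.
  pose proof (atan_exp_bounds u ltac:(lra)) as B.
  unfold gen_integrand, gen_kernel, ln_tan_kernel, dg, scal, opp; simpl.
  unfold mult; simpl.
  destruct (Rle_dec (atan (exp (- u))) 0); [lra|].
  rewrite tan_atan, ln_exp, Ropp_involutive, sin_2a, sin_atan, cos_atan.
  unfold cosh. set (t := exp (- u)).
  assert (Ht : 0 < t) by apply exp_pos.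
  replace (exp u) with (/ t)
    by (unfold t; rewrite exp_Ropp, Rinv_inv; reflexivity).
  unfold Rsqr.
  assert (Hq : sqrt (1 + t * t) * sqrt (1 + t * t) = 1 + t * t)
    by (apply sqrt_sqrt; nra).
  assert (Hq0 : 0 < sqrt (1 + t * t)) by (apply sqrt_lt_R0; nra).
  set (q := sqrt (1 + t * t)) in *.
  replace (2 * (t / q) * (1 / q)) with (2 * t / (1 + t * t))
    by (rewrite <- Hq; field; lra).
  assert (0 < 1 + t * t - z * (2 * t)).
  { replace (1 + t * t - z * (2 * t))
      with ((1 - z) * (1 + t * t) + z * ((1 - t) * (1 - t))) by ring.
    assert (0 < (1 - z) * (1 + t * t)) by (apply Rmult_lt_0_compat; [lra|nra]).
    assert (0 <= z * ((1 - t) * (1 - t)))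
      by (apply Rmult_le_pos; [lra|apply Rle_0_sqr]).
    lra. }
  field. repeat split; nra.
Qed.

Lemma gen_integrand_bounds (z x : R) :
  0 <= z < 1 -> 0 <= x <= PI / 4 -> 0 <= gen_integrand z x <= 2 / (1 - z).
Proof.
intros Hz Hx. unfold gen_integrand.
pose proof (ln_tan_kernel_bounds x Hx) as K.
pose proof (one_sub_sin_pos z x Hz) as S.
assert (0 <= z / (1 - z * sin (2 * x)) <= / (1 - z)).
{ split; [apply Rdiv_le_0_compat; lra|].
  apply Rle_trans with (1 / (1 - z)); [|lra].
  apply Rle_trans with (1 / (1 - z * sin (2 * x))).
  - apply Rmult_le_compat_r; [left; apply Rinv_0_lt_compat|]; lra.
  - apply Rmult_le_compat_l; [lra|]. apply Rinv_le_contravar; lra. }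
unfold Rdiv at 2. split; [apply Rmult_le_pos; lra|].
apply Rmult_le_compat; lra.
Qed.

(** The difference is the integral over [[0, atan (exp (- U))]], an interval of length at most
    [exp (- U) <= 1 / U]. *)
Lemma gen_integral_tail (z U : R) :
  0 <= z < 1 -> 0 < U ->
  Rabs (RInt (gen_integrand z) 0 (PI / 4) - RInt (gen_kernel z) 0 U)
  <= 2 / (1 - z) / U.
Proof.
intros Hz HU. rewrite gen_kernel_subst by lra.
pose proof (atan_exp_bounds U ltac:(lra)) as B.
set (d := atan (exp (- U))) in *.
assert (E1 := ex_RInt_gen_integrand z 0 d Hz ltac:(lra) ltac:(lra)).
assert (E2 := ex_RInt_gen_integrand z d (PI / 4) Hz ltac:(lra) ltac:(lra)).
pose proof (RInt_Chasles (V := R_CompleteNormedModule)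
  (gen_integrand z) 0 d (PI / 4) E1 E2) as Ch.
unfold plus in Ch; simpl in Ch.
assert (Hd : d <= / U).
{ apply Rle_trans with (exp (- U)).
  - apply atan_le_id. left. apply exp_pos.
  - rewrite exp_Ropp. apply Rinv_le_contravar; [trivial|].
    pose proof (exp_ineq1 U ltac:(lra)). lra. }
apply (RInt_correct (V := R_CompleteNormedModule)) in E1.
pose proof (is_RInt_const (V := R_NormedModule) 0 d 0) as I0.
pose proof (is_RInt_const (V := R_NormedModule) 0 d (2 / (1 - z))) as I1.
assert (L0 := is_RInt_le _ _ _ _ _ _ (Rlt_le _ _ (proj1 B)) I0 E1
  (fun x Hx => proj1 (gen_integrand_bounds z x Hz ltac:(lra)))).
assert (L1 := is_RInt_le _ _ _ _ _ _ (Rlt_le _ _ (proj1 B)) E1 I1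
  (fun x Hx => proj2 (gen_integrand_bounds z x Hz ltac:(lra)))).
unfold scal in L0, L1; simpl in L0, L1.
unfold mult in L0, L1; simpl in L0, L1.
rewrite <- Ch.
assert (cancel : forall a b : R, a + b - b = a) by (intros; ring).
rewrite cancel.
rewrite Rabs_pos_eq by lra.
apply Rle_trans with (1 := L1). unfold Rdiv at 2. rewrite Rmult_comm.
rewrite Rminus_0_r. apply Rmult_le_compat_l; [|exact Hd].
apply Rdiv_le_0_compat; lra.
Qed.

Lemma le_of_le_add_inv (a b c : R) :
  0 <= c -> (forall U, 0 < U -> a <= b + c / U) -> a <= b.
Proof.
intros Hc H. apply Rnot_lt_le. intros Hlt.
set (U := (c + 1) / (a - b)).
assert (HU : 0 < U) by (apply Rdiv_lt_0_compat; lra).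
specialize (H U HU).
assert (c / U < a - b).
{ apply Rmult_lt_reg_r with U; [trivial|].
  unfold Rdiv at 1. rewrite Rmult_assoc, Rinv_l by lra.
  unfold U, Rdiv. rewrite (Rmult_comm (c + 1)), <- Rmult_assoc, Rinv_r; lra. }
lra.
Qed.

Lemma gen_integrand_taylor (v : R) (K : nat) :
  0 < v <= 1 -> (1 <= K)%nat ->
  Rabs (RInt (gen_integrand (sin v)) 0 (PI / 4)
        - rsum (fun k => (v / PI) ^ S k * Series (lerch_term (S k))) K)
  <= 15 * 2 ^ K * (v / PI) ^ S K.
Proof.
intros Hv HK. pose proof PI2_3_2 as HPI.
assert (Hz : 0 <= sin v < 1).
{ split.
  - apply sin_ge_0; lra.
  - rewrite <- sin_PI2. apply sin_increasing_1; lra. }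
assert (0 < / (1 - sin v)) by (apply Rinv_0_lt_compat; lra).
(* One summand comes from cutting the integral at [U], the other from the arctangent tails. *)
apply le_of_le_add_inv with (2 / (1 - sin v) + 2); [unfold Rdiv; lra|].
intros U HU.
pose proof (gen_integral_tail (sin v) U Hz HU) as A.
pose proof (gen_integral_taylor v U K Hv HU HK) as B.
rewrite Rdiv_plus_distr.
apply Rabs_le_between in A. apply Rabs_le_between in B. apply Rabs_le. lra.
Qed.

(** The remainder of the geometric sum is [z^(K+1) s^K / (1 - z s)] with [s = sin 2x]. For
    [z <= 1/2] the fraction is at most 2; the factor [2 * ln_tan_kernel x <= 2] gives 4, and the
    interval has length at most 1. *)
Lemma gen_integrand_moments (z : R) (K : nat) :
  0 <= z <= / 2 ->
  Rabs (RInt (gen_integrand z) 0 (PI / 4)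
        - rsum (fun i => z ^ S i * moment i) K) <= 4 * z ^ S K.
Proof.
intros Hz. pose proof PI_RGT_0. pose proof PI_4.
set (f := fun x => rsum (fun i => z ^ S i
            * (2 * ln_tan_kernel x * sin (2 * x) ^ i)) K).
assert (If : is_RInt f 0 (PI / 4) (rsum (fun i => z ^ S i * moment i) K)).
{ apply (is_RInt_rsum (fun i x => z ^ S i
    * (2 * ln_tan_kernel x * sin (2 * x) ^ i))).
  intros i _. apply (is_RInt_scal (V := R_NormedModule)), is_RInt_moment. }
assert (Ig := RInt_correct (V := R_CompleteNormedModule) _ _ _
  (ex_RInt_gen_integrand z 0 (PI / 4) ltac:(lra) ltac:(lra) ltac:(lra))).
pose proof (is_RInt_minus (V := R_NormedModule) _ _ _ _ _ _ Ig If) as Id.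
assert (E : forall x, minus (gen_integrand z x) (f x)
  = 2 * ln_tan_kernel x
    * (z ^ S K * (sin (2 * x) ^ K / (1 - z * sin (2 * x))))).
{ intros x. pose proof (one_sub_sin_pos z x ltac:(lra)) as S.
  unfold minus, plus, opp; simpl. unfold f, gen_integrand.
  set (s := sin (2 * x)) in *. clearbody s. clear - S Hz.
  induction K as [|K IH].
  - simpl. field. lra.
  - cbn [rsum]. rewrite Ropp_plus_distr, <- Rplus_assoc, IH.
    simpl. field. lra. }
assert (B : forall x, 0 < x < PI / 4 ->
  0 <= minus (gen_integrand z x) (f x) <= 4 * z ^ S K).
{ intros x Hx. rewrite E.
  pose proof (one_sub_sin_pos z x ltac:(lra)) as Hd.
  pose proof (ln_tan_kernel_bounds x ltac:(lra)) as Kb.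
  assert (Hs : 0 <= sin (2 * x) <= 1).
  { split; [apply sin_ge_0; lra|]. pose proof (SIN_bound (2 * x)). lra. }
  set (s := sin (2 * x)) in *.
  assert (0 <= s ^ K <= 1).
  { split; [apply pow_le; lra|]. rewrite <- (pow1 K). apply pow_incr. lra. }
  assert (0 <= / (1 - z * s) <= 2).
  { split; [left; apply Rinv_0_lt_compat; lra|].
    rewrite <- (Rinv_inv 2). apply Rinv_le_contravar; lra. }
  assert (0 <= z ^ S K) by (apply pow_le; lra).
  assert (Hq : 0 <= s ^ K / (1 - z * s) <= 1 * 2).
  { split; [apply Rmult_le_pos; lra|apply Rmult_le_compat; lra]. }
  set (q := s ^ K / (1 - z * s)) in *.
  replace (4 * z ^ S K) with ((2 * 1) * (z ^ S K * (1 * 2))) by ring.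
  assert (0 <= z ^ S K * q <= z ^ S K * (1 * 2))
    by (split; [apply Rmult_le_pos|apply Rmult_le_compat_l]; lra).
  split; [apply Rmult_le_pos; lra|apply Rmult_le_compat; lra]. }
pose proof (is_RInt_const (V := R_NormedModule) 0 (PI / 4) 0) as I0.
pose proof (is_RInt_const (V := R_NormedModule) 0 (PI / 4) (4 * z ^ S K)) as I1.
assert (Hpi : 0 <= PI / 4) by lra.
assert (L0 := is_RInt_le _ _ _ _ _ _ Hpi I0 Id
  (fun x Hx => proj1 (B x Hx))).
assert (L1 := is_RInt_le _ _ _ _ _ _ Hpi Id I1
  (fun x Hx => proj2 (B x Hx))).
set (I := RInt (gen_integrand z) 0 (PI / 4)) in *.
set (M := rsum (fun i => z ^ S i * moment i) K) in *.
change ((PI / 4 - 0) * 0 <= I - M) in L0.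
change (I - M <= (PI / 4 - 0) * (4 * z ^ S K)) in L1.
assert (0 <= z ^ S K) by (apply pow_le; lra).
apply Rabs_le. split; nra.
Qed.

(** * Comparison of coefficients *)

(** The remainder is [z^(K+1)] times the shifted series [q], which is continuous and hence bounded
    by [|q 0| + 1] near 0. *)
Lemma PSeries_taylor (a : nat -> R) (K : nat) :
  (forall x, Rabs x < 1 -> ex_pseries a x) ->
  exists B d, 0 < d /\ forall z, 0 < z < d ->
    Rabs (PSeries a z - rsum (fun r => a r * z ^ r) (S K)) <= B * z ^ S K.
Proof.
intros Ha.
set (q := PSeries (PS_decr_n a (S K))).
assert (Cq : continuous q 0).
{ apply continuity_pt_filterlim, PSeries_continuity, radius_ge_1.
  - intros x Hx. apply ex_pseries_decr_n; [|now apply Ha].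
    destruct (Req_dec x 0) as [->|h]; [now left|right].
    exists (/ x). apply Rinv_l, h.
  - rewrite Rabs_R0. lra. }
destruct (proj1 (filterlim_locally _ _) Cq (mkposreal 1 Rlt_0_1)) as [d Hd].
exists (Rabs (q 0) + 1), (Rmin d 1). pose proof (cond_pos d). split.
- apply Rmin_pos; lra.
- intros z Hz.
  pose proof (Rmin_l d 1). pose proof (Rmin_r d 1).
  rewrite (PSeries_decr_n a K) by (apply Ha, Rabs_def1; lra).
  rewrite <- sum_n_Reals, sum_n_rsum. fold q.
  replace (rsum (fun r => a r * z ^ r) (S K) + z ^ S K * q z
           - rsum (fun r => a r * z ^ r) (S K)) with (q z * z ^ S K) by ring.
  rewrite Rabs_mult, (Rabs_pos_eq (z ^ S K)) by (apply pow_le; lra).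
  apply Rmult_le_compat_r; [apply pow_le; lra|].
  assert (Bz : ball 0 d z).
  { unfold ball; simpl. unfold AbsRing_ball, abs, minus, plus, opp; simpl.
    apply Rabs_def1; lra. }
  specialize (Hd z Bz). unfold ball in Hd; simpl in Hd.
  unfold AbsRing_ball, abs, minus, plus, opp in Hd; simpl in Hd.
  pose proof (Rabs_triang_inv (q z) (q 0)).
  change (q z + - q 0) with (q z - q 0) in Hd. lra.
Qed.

Lemma asin_pow_taylor (c : nat -> R) (K n : nat) :
  exists B d, 0 < d /\ forall z, 0 < z < d ->
    Rabs (rsum (fun k => c k * asin z ^ S k) n
          - rsum (fun r => rsum (fun k => c k * asin_pow_coef (S k) r) n
                           * z ^ r) (S K)) <= B * z ^ S K.
Proof.
induction n as [|n [B [d [Hd IH]]]].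
- exists 0, 1. split; [lra|]. intros z Hz.
  rewrite (rsum_zero (fun r => _ * z ^ r) (S K)) by (intros; simpl; ring).
  simpl rsum. rewrite Rminus_0_r, Rabs_R0. lra.
- destruct (PSeries_taylor (asin_pow_coef (S n)) K) as [B' [d' [Hd' H']]].
  { intros x Hx. eexists. now apply is_pseries_asin_pow. }
  exists (B + Rabs (c n) * B'), (Rmin (Rmin d d') 1). split.
  { repeat apply Rmin_pos; lra. }
  intros z Hz.
  pose proof (Rmin_l (Rmin d d') 1). pose proof (Rmin_r (Rmin d d') 1).
  pose proof (Rmin_l d d'). pose proof (Rmin_r d d').
  specialize (IH z ltac:(lra)). specialize (H' z ltac:(lra)).
  rewrite (is_pseries_unique _ _ _
    (is_pseries_asin_pow (S n) z ltac:(apply Rabs_def1; lra))) in H'.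
  replace (rsum (fun r => rsum (fun k => c k * asin_pow_coef (S k) r) (S n)
             * z ^ r) (S K))
    with (rsum (fun r => rsum (fun k => c k * asin_pow_coef (S k) r) n
             * z ^ r) (S K)
          + c n * rsum (fun r => asin_pow_coef (S n) r * z ^ r) (S K)).
  2:{ rewrite <- rsum_scal, <- rsum_plus. apply rsum_ext. intros r _.
      change (rsum (fun k => c k * asin_pow_coef (S k) r) (S n))
        with (rsum (fun k => c k * asin_pow_coef (S k) r) n
              + c n * asin_pow_coef (S n) r). ring. }
  change (rsum (fun k => c k * asin z ^ S k) (S n))
    with (rsum (fun k => c k * asin z ^ S k) n + c n * asin z ^ S n).
  assert (M : Rabs (c n * (asin z ^ S n
      - rsum (fun r => asin_pow_coef (S n) r * z ^ r) (S K)))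
    <= Rabs (c n) * (B' * z ^ S K)).
  { rewrite Rabs_mult. apply Rmult_le_compat_l; [apply Rabs_pos|exact H']. }
  apply Rabs_le_between in IH. apply Rabs_le_between in M.
  rewrite Rmult_plus_distr_r, Rmult_assoc.
  apply Rabs_le. lra.
Qed.

(** The constant term is [O(z)], hence 0; a factor [z] then cancels and the induction continues with
    the shifted coefficients. *)
Lemma polynomial_vanishes (N : nat) : forall e : nat -> R,
  (exists B d, 0 < d /\ forall z, 0 < z < d ->
     Rabs (rsum (fun r => e r * z ^ r) N) <= B * z ^ N) ->
  forall r, (r < N)%nat -> e r = 0.
Proof.
induction N as [|N IH]; intros e [B [d [Hd H]]] r Hr; [lia|].
assert (E : forall z, rsum (fun r => e r * z ^ r) (S N)
  = e 0%nat + z * rsum (fun r => e (S r) * z ^ r) N).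
{ intros z. rewrite rsum_S_l, <- rsum_scal. f_equal; [simpl; ring|].
  apply rsum_ext. intros k _. simpl. ring. }
set (M := Rabs B + rsum (fun r => Rabs (e (S r))) N).
assert (HM : 0 <= M).
{ unfold M. pose proof (Rabs_pos B).
  assert (rsum (fun _ => 0) N <= rsum (fun r => Rabs (e (S r))) N)
    by (apply rsum_le; intros; apply Rabs_pos).
  rewrite (rsum_zero (fun _ => 0)) in H1 by reflexivity. lra. }
assert (Hz : forall z, 0 < z < Rmin d 1 -> Rabs (e 0%nat) <= z * M).
{ intros z Hz. pose proof (Rmin_l d 1). pose proof (Rmin_r d 1).
  specialize (H z ltac:(lra)). rewrite E in H.
  assert (pw : forall k, 0 <= z ^ k <= 1).
  { intros k. split; [apply pow_le; lra|].
    rewrite <- (pow1 k). apply pow_incr. lra. }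
  assert (T : Rabs (rsum (fun r => e (S r) * z ^ r) N)
              <= rsum (fun r => Rabs (e (S r))) N).
  { apply Rle_trans with (1 := rsum_Rabs _ _). apply rsum_le. intros k _.
    rewrite Rabs_mult, (Rabs_pos_eq (z ^ k)) by apply pw.
    pose proof (Rabs_pos (e (S k))). pose proof (pw k). nra. }
  assert (B * z ^ S N <= z * Rabs B).
  { simpl. pose proof (pw N). pose proof (Rle_abs B). pose proof (Rabs_pos B).
    assert (B * z ^ N <= Rabs B) by nra. nra. }
  set (q := rsum (fun r => e (S r) * z ^ r) N) in *.
  pose proof (Rabs_triang (e 0%nat + z * q) (- (z * q))) as Tr.
  replace (e 0%nat + z * q + - (z * q)) with (e 0%nat) in Tr by ring.
  rewrite Rabs_Ropp, Rabs_mult, (Rabs_pos_eq z) in Tr by lra.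
  unfold M. nra. }
assert (e0 : e 0%nat = 0).
{ apply Rabs_eq_0. apply Rle_antisym; [|apply Rabs_pos].
  assert (Hm : 0 < Rmin d 1) by (apply Rmin_pos; lra).
  apply le_of_le_add_inv with M; [exact HM|]. intros U HU.
  set (z := Rmin (/ U) (Rmin d 1 / 2)).
  assert (0 < / U) by (apply Rinv_0_lt_compat, HU).
  assert (Z1 : 0 < z) by (apply Rmin_pos; lra).
  pose proof (Rmin_l (/ U) (Rmin d 1 / 2)) as Z2.
  pose proof (Rmin_r (/ U) (Rmin d 1 / 2)) as Z3.
  fold z in Z2, Z3.
  specialize (Hz z ltac:(lra)). rewrite Rplus_0_l. unfold Rdiv.
  assert (z * M <= M * / U) by (rewrite Rmult_comm;
    apply Rmult_le_compat_l; lra). lra. }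
destruct r as [|r]; [exact e0|].
apply (IH (fun r => e (S r))); [|lia].
exists B, d. split; [exact Hd|]. intros z Hz'. specialize (H z Hz').
rewrite E, e0, Rplus_0_l, Rabs_mult, (Rabs_pos_eq z) in H by lra.
apply Rmult_le_reg_l with z; [lra|].
replace (z * (B * z ^ N)) with (B * z ^ S N) by (simpl; ring). exact H.
Qed.

(** Coefficient of [v^(k+1)] in the generating function at [z = sin v]. *)
Definition taylor_coef (k : nat) : R := Series (lerch_term (S k)) / PI ^ S k.

(** The generating integral is expanded in powers of [z] by the moments and in powers of
    [v = asin z] by the Lerch series. Both expansions are known up to [O(z^(K+1))], so the
    coefficients agree up to degree [K]. *)
Lemma moment_eq (K i : nat) : (i < K)%nat ->
  moment i = rsum (fun k => taylor_coef k * asin_pow_coef (S k) (S i)) K.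
Proof.
intros Hi.
set (e := fun r => coef_shift moment r
  - rsum (fun k => taylor_coef k * asin_pow_coef (S k) r) K).
cut (e (S i) = 0); [unfold e; cbn [coef_shift]; lra|].
apply (polynomial_vanishes (S K)); [|lia].
destruct (asin_pow_taylor taylor_coef K K) as [B [d [Hd H]]].
(* The three constants bound the errors of the expansion in [v], of the expansion in moments, and of
   rewriting powers of [asin z] in powers of [z]. For [z < 1/4] one gets [v < 1/2] and [v <= 2 z],
   whence the factor [2^(K+1)]. *)
exists (15 * 2 ^ K * 2 ^ S K + 4 + B), (Rmin d (/ 4)).
split; [apply Rmin_pos; lra|].
intros z Hz. pose proof (Rmin_l d (/ 4)). pose proof (Rmin_r d (/ 4)).
specialize (H z ltac:(lra)).
pose proof PI2_3_2 as HPI.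
pose proof (gen_integrand_moments z K ltac:(lra)) as M.
set (v := asin z) in *.
assert (Hsv : sin v = z) by (apply sin_asin; lra).
pose proof (asin_bound z) as Bv. fold v in Bv.
assert (Hv0 : 0 < v).
{ apply Rnot_le_lt. intros h.
  assert (sin v <= sin 0) by (apply sin_incr_1; lra).
  rewrite sin_0 in *. lra. }
assert (Hv1 : v < / 2).
{ apply Rnot_le_lt. intros h.
  assert (sin (/ 2) <= sin v) by (apply sin_incr_1; lra).
  pose proof (sin_ge_cubic (/ 2) ltac:(lra)). lra. }
assert (Hv2 : v <= 2 * z).
{ pose proof (sin_ge_cubic v ltac:(lra)). nra. }
pose proof (gen_integrand_taylor v K ltac:(lra) ltac:(lia)) as T.
rewrite Hsv in T.
rewrite (rsum_ext (fun k => (v / PI) ^ S k * Series (lerch_term (S k)))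
  (fun k => taylor_coef k * v ^ S k)) in T.
2:{ intros k _. unfold taylor_coef, Rdiv. rewrite Rpow_mult_distr, pow_inv.
    ring. }
assert (Hp : (v / PI) ^ S K <= 2 ^ S K * z ^ S K).
{ rewrite <- Rpow_mult_distr. apply pow_incr.
  assert (0 < / PI <= 1).
  { split; [apply Rinv_0_lt_compat; lra|].
    rewrite <- Rinv_1. apply Rinv_le_contravar; lra. }
  unfold Rdiv. nra. }
assert (Hc : 0 <= 15 * 2 ^ K).
{ assert (0 < 2 ^ K) by (apply pow_lt; lra). lra. }
apply (Rmult_le_compat_l _ _ _ Hc) in Hp.
replace (rsum (fun r => e r * z ^ r) (S K))
  with (rsum (fun i => z ^ S i * moment i) K
        - rsum (fun r => rsum (fun k => taylor_coef k
            * asin_pow_coef (S k) r) K * z ^ r) (S K)).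
2:{ rewrite (rsum_ext (fun r => e r * z ^ r) (fun r => coef_shift moment r * z ^ r
      - rsum (fun k => taylor_coef k * asin_pow_coef (S k) r) K * z ^ r))
      by (intros; unfold e; ring).
    rewrite rsum_minus, rsum_coef_shift, <- rsum_scal. f_equal.
    apply rsum_ext. intros k _. simpl. ring. }
apply Rabs_le_between in H. apply Rabs_le_between in M.
apply Rabs_le_between in T.
rewrite !Rmult_plus_distr_r.
apply Rabs_le. lra.
Qed.

(** * Assembly of the integral from moments, Chebyshev coefficients and Lerch values *)

Lemma is_RInt_chebU (n eps : nat) (b : nat -> R) :
  (1 <= n)%nat -> chebU_coefs (2 * n - 2 + eps) b ->
  is_RInt
    (fun x : R =>
       cos ((4 * INR n - 2 + 2 * INR eps) * x - PI * INR eps / 2)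
         / ln (tan x))
    0 (PI / 4)
    ((-1) ^ n / 2 * rsum (fun i => b i * moment i) (S (2 * n - 2 + eps))).
Proof.
intros Hn [Hb _]. pose proof PI_RGT_0. set (m := (2 * n - 2 + eps)%nat) in *.
apply is_RInt_ext with (fun x => (-1) ^ n / 2 * rsum (fun i => b i
  * (2 * ln_tan_kernel x * sin (2 * x) ^ i)) (S m)).
- intros x Hx. rewrite Rmin_left, Rmax_right in Hx by lra.
  rewrite integrand_eq by trivial. fold m.
  rewrite (Hb _ (S m)) by lia.
  rewrite (rsum_ext _ (fun i => 2 * ln_tan_kernel x * (b i * sin (2 * x) ^ i)))
    by (intros; ring).
  rewrite rsum_scal.
  match goal with |- @eq _ ?a ?b => change (@eq R a b) end. field.
- apply (is_RInt_scal (V := R_NormedModule)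
    (fun x => rsum (fun i => b i * (2 * ln_tan_kernel x * sin (2 * x) ^ i)) (S m))).
  apply (is_RInt_rsum (fun i x => b i
    * (2 * ln_tan_kernel x * sin (2 * x) ^ i))).
  intros i _. apply (is_RInt_scal (V := R_NormedModule)), is_RInt_moment.
Qed.

(** The surviving indices are [k = 2 p + e], which produces the step 2 in the exponents of the final
    sum. *)
Lemma rsum_one_parity (X : nat -> R) (q e : nat) :
  (e = 0%nat \/ e = 1%nat) ->
  (forall k, Nat.odd (k + e) = true -> X k = 0) ->
  rsum X (S (2 * q + e)) = rsum (fun p => X (2 * p + e)%nat) (S q).
Proof.
intros He HX.
assert (odd_step : forall p, X (S (2 * p + e)) = 0).
{ intros p. apply HX. rewrite Nat.add_succ_l, Nat.odd_succ.
  apply Nat.even_spec. exists (p + e)%nat. lia. }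
induction q as [|q IH].
- destruct He as [-> | ->]; simpl; [reflexivity|].
  rewrite (HX 0%nat) by reflexivity. ring.
- replace (S (2 * S q + e)) with (S (S (S (2 * q + e)))) by lia.
  change (rsum X (S (S (S (2 * q + e)))))
    with (rsum X (S (2 * q + e)) + X (S (2 * q + e)) + X (S (S (2 * q + e)))).
  rewrite IH, odd_step.
  change (rsum (fun p => X (2 * p + e)%nat) (S (S q)))
    with (rsum (fun p => X (2 * p + e)%nat) (S q) + X (2 * S q + e)%nat).
  replace (2 * S q + e)%nat with (S (S (2 * q + e))) by lia. ring.
Qed.

Lemma sum_n_m_rsum (f : nat -> R) (n : nat) :
  sum_n_m f 1 n = rsum (fun p => f (S p)) n.
Proof.
induction n as [|n IH].
- rewrite sum_n_m_zero by lia. reflexivity.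
- rewrite sum_n_Sm, IH by lia. reflexivity.
Qed.

(** Here [p] counts from 0. For both values of [eps], [2 eps - 1] equals [(-1)^(2 p + eps + 1)], and
    the real power has a natural exponent. *)
Lemma Lerch_lerch_term (p eps : nat) :
  eps = 0%nat \/ eps = 1%nat ->
  Lerch (2 * INR eps - 1) (2 * INR (S p) + INR eps) (1 / 2)
  = Series (lerch_term (S (2 * p + eps))).
Proof.
intros He. apply Series_ext. intros j. unfold lerch_term.
replace (2 * INR (S p) + INR eps) with (INR (S (S (2 * p + eps))))
  by (rewrite !S_INR, plus_INR, mult_INR; simpl (INR 2); ring).
replace (1 / 2) with (/ 2) by field.
rewrite Rpower_pow by (pose proof (half_shift_pos j); lra).
do 2 f_equal.
change (S (2 * p + eps)) with (1 + (2 * p + eps))%nat.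
rewrite !pow_add, pow_1_even. destruct He as [-> | ->]; simpl; ring.
Qed.

Theorem proposition3p4 (n eps : nat) (hn : (1 <= n)%nat)
    (heps : eps = 0%nat \/ eps = 1%nat) :
  is_RInt
    (fun x : R =>
       cos ((4 * INR n - 2 + 2 * INR eps) * x - PI * INR eps / 2)
         / ln (tan x))
    0 (PI / 4)
    ((-1) ^ n / 2 *
     sum_n_m (fun p : nat =>
       Lerch (2 * INR eps - 1) (2 * INR p + INR eps) (1 / 2)
         / PI ^ (2 * p - 1 + eps)
         * laurent_coeff 1 (fun x : R =>
             ChebyshevU (2 * n - 2 + eps) (1 / x)
               * asin x ^ (2 * p - 1 + eps)))
       1 n).
Proof.
destruct (chebU_coefs_exist (2 * n - 2 + eps)) as [b Hb].
pose proof (is_RInt_chebU n eps b hn Hb) as H.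
match goal with |- is_RInt _ _ _ (_ * ?s) => set (rhs := s) end.
replace rhs with (rsum (fun i => b i * moment i) (S (2 * n - 2 + eps)));
  [exact H|unfold rhs; clear H rhs].
destruct n as [|q]; [lia|].
set (m := (2 * S q - 2 + eps)%nat) in *.
rewrite sum_n_m_rsum.
(* The contribution of [asin^(k+1)]; exchanging the sums over [i] and [k] brings out the Laurent
   coefficient. *)
set (X := fun k => taylor_coef k
  * rsum (fun i => b i * asin_pow_coef (S k) (S i)) (S m)).
assert (E : rsum (fun i => b i * moment i) (S m) = rsum X (S m)).
{ unfold X.
  rewrite (rsum_ext _ (fun i => rsum (fun k =>
    taylor_coef k * (b i * asin_pow_coef (S k) (S i))) (S m))).
  - rewrite rsum_swap. apply rsum_ext. intros k _. apply rsum_scal.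
  (* The single truncation [K = m + 1] is valid for every [i <= m], so the exchanged sums have fixed
     bounds. *)
  - intros i Hi. rewrite (moment_eq (S m) i Hi), <- rsum_scal.
    apply rsum_ext. intros k _. ring. }
rewrite E.
replace (S m) with (S (2 * q + eps)) by (unfold m; lia).
rewrite rsum_one_parity.
- apply rsum_ext. intros p _. unfold X.
  rewrite Lerch_lerch_term by exact heps.
  replace (2 * S p - 1 + eps)%nat with (S (2 * p + eps)) by lia.
  now rewrite (laurent_coeff_chebU_asin m _ b Hb).
- exact heps.
(* Since [m] has the parity of [eps] and [k + eps] is odd, either [i + m] is odd and [b i] vanishes,
   or [i + k] is odd and the arcsine coefficient does. *)
- intros k Hk. unfold X. rewrite rsum_zero; [ring|]. intros i _.
  destruct (Nat.odd (i + m)) eqn:Ei.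
  + rewrite (proj2 Hb i Ei). ring.
  + rewrite asin_pow_coef_parity; [ring|].
    rewrite Nat.add_succ_l, Nat.add_succ_r, Nat.odd_succ_succ.
    replace m with (2 * q + eps)%nat in Ei by (unfold m; lia).
    rewrite !Nat.odd_add, Nat.odd_mul in Ei. simpl in Ei.
    rewrite Nat.odd_add in *.
    destruct (Nat.odd i), (Nat.odd k), (Nat.odd eps); simpl in *; congruence.
Qed.
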